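(* Let $1\le r<n$ be integers, let $G_{n,r}$ be the Higman--Thompson group acting on $\mathfrak C_{n,r}$, and let $\mathcal R_{n,r}$ be the (generalized) rational group of homeomorphisms of $\mathfrak C_{n,r}$, i.e. those homeomorphisms representable by finite initial transducers. The subgroup $\mathcal B_{n,r}$ of $\mathcal R_{n,r}$ consisting of the homeomorphisms representable by bi-synchronizing finite transducers contains $G_{n,r}$, and $\mathcal B_{n,r}$ is isomorphic to $\operatorname{Aut}(G_{n,r})$.
   Context: Spaces. $X_n=\{0,1,\dots,n-1\}$, and $\dot{\mathbf r}$ is a set of $r$ symbols disjoint from $X_n$ (''dotted letters''). $\mathfrak C_n=X_n^\omega$ and $\mathfrak C_{n,r}=\{c a_1a_2a_3\ldots : c\in\dot{\mathbf r},\ a_i\in X_n\}$, with the product topologies. $\varepsilon$ is the empty word. $W_{n,r,\varepsilon}$ is the set of finite words $ca_1\ldots a_k$ with $c\in\dot{\mathbf r}$, $k\ge 0$, $a_i\in X_n$. For $\eta\in W_{n,r,\varepsilon}$, $U_\eta=\{\eta x: x\in\mathfrak C_n\}$. The group $G_{n,r}$. A complete antichain is a finite set of words in $W_{n,r,\varepsilon}$, none a prefix of another, such that every word of $W_{n,r,\varepsilon}$ has a prefix in the set or is a prefix of an element of the set. $G_{n,r}$ is the group of homeomorphisms $g$ of $\mathfrak C_{n,r}$ for which there are complete antichains $\{\eta_0,\dots,\eta_{k-1}\}$, $\{\zeta_0,\dots,\zeta_{k-1}\}$ of the same size with $(\eta_i x)g=\zeta_i x$ for all $i$ and all $x\in\mathfrak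 C_n$. Transducers for $\mathfrak C_{n,r}$. Such a (non-degenerate, initial) transducer is a tuple $A_{q_0}=(\dot{\mathbf r},X_n,R,S,\pi,\lambda,q_0)$ where $R$ is a finite set and $S$ a finite or countable set disjoint from $R$, $Q=R\sqcup S$ is the set of states, $q_0\in R$; the transition function $\pi$ and output function $\lambda$ are defined on the pairs $(x,q)$ with $x\in\dot{\mathbf r}$ if $q=q_0$ and $x\in X_n$ if $q\in Q\setminus\{q_0\}$; $\pi$ takes values in $Q\setminus\{q_0\}$ and $\lambda$ takes values in finite words, subject to: (1) if $\pi(x,q)\in R$ then $q\in R$ and $\lambda(x,q)=\varepsilon$; (2) if $q\in R$ and $\pi(x,q)\in S$ then $\lambda(x,q)\in W_{n,r,\varepsilon}$ (a nonempty word starting with a dotted letter); (3) if $q\in S$ then $\pi(x,q)\in S$ and $\lambda(x,q)\in X_n^*$; and, extending to words by $\pi(\mu\nu,q)=\pi(\nu,\pi(\mu,q))$, $\lambda(\mu\nu,q)=\lambda(\mu,q)\lambda(\nu,\pi(\mu,q))$ and extending $\lambda$ to infinite inputs in the obvious way, (4) if $w$ is nonempty and $\pi(w,q)=q$ then $\lambda(w,q)\ne\varepsilon$; (5) if $q\in S$, $x\in\mathfrak C_n$, then $\lambda(x,q)\in\mathfrak C_n$. $A_{q_0}$ represents the continuous map $h_{A_{q_0}}:\mathfrak C_{n,r}\to\mathfrak C_{n,r}$, $x\mapsto\lambda(x,q_0)$. It is finite if $Q$ is finite. $\mathcal R_{n,r}$ is the group of homeomorphisms of $\mathfrak C_{n,r}$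 represented by finite transducers. Synchronization. $A_{q_0}$ is synchronizing at level $m$ if for every valid input word $w$ of length $m$ there is a state $\mathfrak s(w)$ with $\pi(w,q)=\mathfrak s(w)$ for all states $q$ from which $w$ can be read (words beginning with a dotted letter are read only from $q_0$, words in $X_n^m$ from any state other than $q_0$). It is strongly synchronizing if it is synchronizing at some level $m$. A homeomorphism is representable by a bi-synchronizing transducer if both it and its inverse are representable by finite strongly synchronizing transducers. *)

(* Defs.v *)
Set Warnings "-notation-overridden,-notation-incompatible-prefix,-redundant-canonical-projection,-projection-no-head-constant".
From HB Require Import structures.
From mathcomp Require Import all_boot all_classical topology.

Set Implicit Arguments.
Unset Strict Implicit.
Unset Printing Implicit Defensive.

Local Open Scope classical_set_scope.
Local Open Scope group_scope.

Record subgroup (gT : groupType) := Subgroup {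
  subgroup_set :> set gT;
  subgroupP : group_closed (mem subgroup_set)
}.

Definition subgroup_type (gT : groupType) (H : subgroup gT) : Type :=
  {x : gT | x \in subgroup_set H}.

HB.instance Definition _ (gT : groupType) (H : subgroup gT) :=
  SubType.on (subgroup_type H).
HB.instance Definition _ (gT : groupType) (H : subgroup gT) :=
  [Choice of subgroup_type H by <:].
HB.instance Definition _ (gT : groupType) (H : subgroup gT) :=
  SubChoice_isSubGroup.Build gT (fun x => x \in subgroup_set H)
    (subgroup_type H) (subgroupP H).

Definition isomorphic (gT hT : groupType) : Prop :=
  exists f : {multiplicative gT -> hT}, bijective f.

(* Maps act on the right: [f * g] is [f] followed by [g], in [homeo T] and in
   [Aut gT]. *)
Record homeo (T : topologicalType) := Homeo {
  homeo_fun :> T -> T;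
  homeoP : continuous homeo_fun /\
    exists g : T -> T,
      [/\ cancel homeo_fun g, cancel g homeo_fun & continuous g]
}.

HB.instance Definition _ (T : topologicalType) := gen_eqMixin (homeo T).
HB.instance Definition _ (T : topologicalType) := gen_choiceMixin (homeo T).

Section HomeoGroup.
Variable T : topologicalType.
Implicit Types f g h : homeo T.

Lemma homeo_ext f g : f =1 g -> f = g.
Proof.
case: f g => [f fP] [g gP] /= /funext efg; move: fP gP; rewrite efg => fP gP.
by congr Homeo; exact: Prop_irrelevance.
Qed.

Fact homeo_one_subproof : continuous (@idfun T) /\
  exists g : T -> T, [/\ cancel idfun g, cancel g idfun & continuous g].
Proof. by split; [|exists idfun; split] => // x; exact: cvg_id. Qed.

Definition homeo_one : homeo T := Homeo homeo_one_subproof.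

Fact homeo_mul_subproof f g : continuous (g \o f) /\
  exists k : T -> T, [/\ cancel (g \o f) k, cancel k (g \o f) & continuous k].
Proof.
case: (homeoP f) (homeoP g) => cf [f' [fK f'K cf']] [cg [g' [gK g'K cg']]].
split; first by move=> x; apply: continuous_comp; [exact: cf|exact: cg].
exists (f' \o g'); split; [exact: can_comp|exact: can_comp|].
by move=> x; apply: continuous_comp; [exact: cg'|exact: cf'].
Qed.

Definition homeo_mul f g : homeo T := Homeo (homeo_mul_subproof f g).

Lemma homeo_inv_subproof f :
  exists g : homeo T, cancel f g /\ cancel g f.
Proof.
case: (homeoP f) => cf [g [fK gK cg]].
have gP : continuous g /\
    exists k : T -> T, [/\ cancel g k, cancel k g & continuous k].
  by split=> //; exists f.
by exists (Homeo gP).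
Qed.

Definition homeo_inv f : homeo T := projT1 (cid (homeo_inv_subproof f)).

Lemma homeoK f : cancel f (homeo_inv f).
Proof. by rewrite /homeo_inv; case: cid => g []. Qed.

Lemma homeoVK f : cancel (homeo_inv f) f.
Proof. by rewrite /homeo_inv; case: cid => g []. Qed.

Fact homeo_mulA : associative homeo_mul.
Proof. by move=> f g h; exact: homeo_ext. Qed.
Fact homeo_mul1 : left_id homeo_one homeo_mul.
Proof. by move=> f; exact: homeo_ext. Qed.
Fact homeo_mulr1 : right_id homeo_one homeo_mul.
Proof. by move=> f; exact: homeo_ext. Qed.
Fact homeo_mulV : left_inverse homeo_one homeo_inv homeo_mul.
Proof. by move=> f; apply: homeo_ext => x /=; rewrite homeoVK. Qed.
Fact homeo_mulrV : right_inverse homeo_one homeo_inv homeo_mul.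
Proof. by move=> f; apply: homeo_ext => x /=; rewrite homeoK. Qed.

HB.instance Definition _ := isGroup.Build (homeo T)
  homeo_mulA homeo_mul1 homeo_mulr1 homeo_mulV homeo_mulrV.

End HomeoGroup.

Record Aut (gT : groupType) := Automorphism {
  aut_fun :> gT -> gT;
  aut_morph : {morph aut_fun : x y / x * y};
  aut_bij : bijective aut_fun
}.

HB.instance Definition _ (gT : groupType) := gen_eqMixin (Aut gT).
HB.instance Definition _ (gT : groupType) := gen_choiceMixin (Aut gT).

Section AutGroup.
Variable gT : groupType.
Implicit Types a b c : Aut gT.

Lemma aut_ext a b : a =1 b -> a = b.
Proof.
case: a b => [f fM fB] [g gM gB] /= /funext efg.
move: fM fB gM gB; rewrite efg => fM fB gM gB.
by congr Automorphism; exact: Prop_irrelevance.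
Qed.

Definition aut_one : Aut gT :=
  @Automorphism gT idfun (fun _ _ => erefl) (Bijective (frefl _) (frefl _)).

Fact aut_mul_subproof a b : {morph b \o a : x y / x * y}.
Proof. by move=> x y /=; rewrite !aut_morph. Qed.

Definition aut_mul a b : Aut gT :=
  Automorphism (aut_mul_subproof a b) (bij_comp (aut_bij b) (aut_bij a)).

Lemma aut_inv_subproof a : exists b : Aut gT, cancel a b /\ cancel b a.
Proof.
have [g aK gK] := aut_bij a.
have gM : {morph g : x y / x * y}.
  by move=> x y; apply: (can_inj aK); rewrite aut_morph !gK.
by exists (Automorphism gM (Bijective gK aK)).
Qed.

Definition aut_inv a : Aut gT := projT1 (cid (aut_inv_subproof a)).

Lemma autK a : cancel a (aut_inv a).
Proof. by rewrite /aut_inv; case: cid => g []. Qed.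

Lemma autVK a : cancel (aut_inv a) a.
Proof. by rewrite /aut_inv; case: cid => g []. Qed.

Fact aut_mulA : associative aut_mul.
Proof. by move=> a b c; exact: aut_ext. Qed.
Fact aut_mul1 : left_id aut_one aut_mul.
Proof. by move=> a; exact: aut_ext. Qed.
Fact aut_mulr1 : right_id aut_one aut_mul.
Proof. by move=> a; exact: aut_ext. Qed.
Fact aut_mulV : left_inverse aut_one aut_inv aut_mul.
Proof. by move=> a; apply: aut_ext => x /=; rewrite autVK. Qed.
Fact aut_mulrV : right_inverse aut_one aut_inv aut_mul.
Proof. by move=> a; apply: aut_ext => x /=; rewrite autK. Qed.

HB.instance Definition _ := isGroup.Build (Aut gT)
  aut_mulA aut_mul1 aut_mulr1 aut_mulV aut_mulrV.

End AutGroup.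

(* A point [c a_1 a_2 ...] of [cantor_dot n r] is the pair of
    its dotted letter [c] and the sequence of its undotted letters. *)
Definition cantor (n : nat) : topologicalType :=
  prod_topology (fun _ : nat => discrete_topology 'I_n).

Definition cantor_dot (n r : nat) : topologicalType :=
  (discrete_topology 'I_r * cantor n)%type.

(* The pair [(c, s)] is the word [c a_1 ... a_k], an element of
   [W_{n,r,epsilon}]. *)
Definition dword (n r : nat) : Type := ('I_r * seq 'I_n)%type.

Section Words.
Variables n r : nat.
Implicit Types (w v : dword n r) (x : cantor n).

Definition dprefix w v : bool := (w.1 == v.1) && prefix w.2 v.2.

Definition prepend (s : seq 'I_n) x : cantor n :=
  fun k => if k < size s then nth (x 0) s k else x (k - size s)%N.

(* the infinite word [w x] *)
Definition dcat w x : cantor_dot n r := (w.1, prepend w.2 x).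

(* A finite set of words is given by an enumeration without repetition; the
   first condition implies that [eta] is injective. *)
Definition complete_antichain (I : finType) (eta : I -> dword n r) : Prop :=
  (forall i j, dprefix (eta i) (eta j) -> i = j) /\
  (forall w, exists i, dprefix (eta i) w || dprefix w (eta i)).

Definition higman_thompson_set : set (homeo (cantor_dot n r)) :=
  [set g | exists k : nat, exists eta zeta : 'I_k -> dword n r,
    [/\ complete_antichain eta, complete_antichain zeta &
        forall i x, g (dcat (eta i) x) = dcat (zeta i) x]].

Definition wcat w (s : seq 'I_n) : dword n r := (w.1, w.2 ++ s).

Lemma prepend_cat s t x : prepend (s ++ t) x = prepend s (prepend t x).
Proof.
apply/funext => k; rewrite /prepend size_cat nth_cat.
case: (ltnP k (size s)) => [ks|sk].
  by rewrite (leq_trans ks (leq_addr _ _)); exact: set_nth_default.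
rewrite -[in RHS]subnDA.
by have -> : (k - size s < size t) = (k < size s + size t) by rewrite ltn_subLR.
Qed.

Lemma dcat_wcat w s x : dcat (wcat w s) x = dcat w (prepend s x).
Proof. by rewrite /dcat /= prepend_cat. Qed.

Lemma dprefixP w v : reflect (exists s, v = wcat w s) (dprefix w v).
Proof.
apply: (iffP andP) => [[/eqP e /prefixP[s es]]|[s ->]].
  by exists s; case: v e es => ? ? /= <- ->.
by rewrite /= eqxx; split=> //; exact: prefix_prefix.
Qed.

Lemma dprefix_comparable a b c :
  dprefix a c -> dprefix b c -> dprefix a b || dprefix b a.
Proof.
case/andP => /eqP ac pac /andP[/eqP bc pbc].
rewrite /dprefix ac bc eqxx /=.
move: pac pbc; rewrite !prefixE => /eqP pa /eqP pb.
case: (leqP (size a.2) (size b.2)) => [ab|/ltnW ab].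
  by rewrite -[in X in X || _]pb take_takel // pa eqxx.
by apply/orP; right; rewrite -[in X in take _ X]pa take_takel // pb.
Qed.

Lemma dprefix_trans : transitive dprefix.
Proof.
move=> b a c /dprefixP[s ->] /dprefixP[t ->]; apply/dprefixP.
by exists (s ++ t); rewrite /wcat /= catA.
Qed.

Definition wext w v : seq 'I_n := drop (size w.2) v.2.

Lemma wextE w v : dprefix w v -> wcat w (wext w v) = v.
Proof.
by case/dprefixP=> s ->; rewrite /wcat /wext /= drop_size_cat.
Qed.

Lemma wext_nil w v : dprefix v w -> wext w v = [::].
Proof.
by case/dprefixP=> s ->; rewrite /wext /= drop_oversize // size_cat leq_addr.
Qed.

Lemma wcatw0 w : wcat w [::] = w.
Proof. by case: w => c s; rewrite /wcat cats0. Qed.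

Lemma wext_join w v : dprefix w v || dprefix v w ->
  wcat w (wext w v) = wcat v (wext v w).
Proof.
by case/orP => h; rewrite (wextE h) (wext_nil h) wcatw0.
Qed.

Lemma antichain_eq (I : finType) (eta : I -> dword n r) i j c :
  complete_antichain eta -> dprefix (eta i) c -> dprefix (eta j) c -> i = j.
Proof.
case=> anti _ pi pj; case/orP: (dprefix_comparable pi pj) => /anti //.
Qed.

Lemma dprefix_wcat w s : dprefix w (wcat w s).
Proof. by apply/dprefixP; exists s. Qed.

Lemma dprefix_wcat2 w s t : dprefix (wcat w s) (wcat w t) = prefix s t.
Proof. by rewrite /dprefix /= eqxx; elim: w.2 => //= a u IH; rewrite eqxx. Qed.

Definition dcomparable w v := dprefix w v || dprefix v w.

Lemma refine_antichain (I J K : finType) (eta zeta : I -> dword n r)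
    (theta : J -> dword n r) (a : K -> I) (b : K -> J) :
  complete_antichain eta -> complete_antichain zeta ->
  complete_antichain theta ->
  (forall k, dcomparable (zeta (a k)) (theta (b k))) ->
  (forall i j, dcomparable (zeta i) (theta j) -> exists k, a k = i /\ b k = j) ->
  (forall k l, a k = a l -> b k = b l -> k = l) ->
  complete_antichain
    (fun k => wcat (eta (a k)) (wext (zeta (a k)) (theta (b k)))).
Proof.
move=> Heta Hzeta Htheta cab abs abi; split.
  move=> k l kl; have akl : a k = a l.
    apply: (antichain_eq Heta (dprefix_trans (dprefix_wcat _ _) kl)).
    exact: dprefix_wcat.
  apply: abi => //; move: kl; rewrite akl dprefix_wcat2 => kl.
  have: dprefix (wcat (zeta (a k)) (wext (zeta (a k)) (theta (b k))))
                (wcat (zeta (a l)) (wext (zeta (a l)) (theta (b l)))).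
    by rewrite akl dprefix_wcat2.
  rewrite !(wext_join (cab _)) => h.
  apply: (antichain_eq Htheta (dprefix_trans (dprefix_wcat _ _) h)).
  exact: dprefix_wcat.
move=> w; have [i /orP[/dprefixP[t ->]|wi]] := Heta.2 w; last first.
  have [j cj] := Htheta.2 (zeta i).
  have [|k [ak bk]] := abs i j; first by rewrite /dcomparable orbC.
  exists k; apply/orP; right; apply: (dprefix_trans wi); rewrite ak.
  exact: dprefix_wcat.
have [j] := Htheta.2 (wcat (zeta i) t).
case/orP => h.
  have cij : dcomparable (zeta i) (theta j).
    exact: dprefix_comparable (dprefix_wcat _ _) h.
  have [k [ak bk]] := abs _ _ cij; exists k; rewrite ak bk.
  apply/orP; left; rewrite dprefix_wcat2.
  case/orP: cij => c; last by rewrite wext_nil // prefix0s.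
  by rewrite -(dprefix_wcat2 (zeta i)) wextE.
have zj := dprefix_trans (dprefix_wcat _ _) h.
have [|k [ak bk]] := abs i j; first by rewrite /dcomparable zj.
exists k; rewrite ak bk; apply/orP; right.
by rewrite dprefix_wcat2 -(dprefix_wcat2 (zeta i)) wextE.
Qed.

Lemma higman_thompson_mul g h :
  higman_thompson_set g -> higman_thompson_set h -> higman_thompson_set (g * h).
Proof.
move=> [k [eta [zeta [Heta Hzeta gE]]]] [l [theta [xi [Htheta Hxi hE]]]].
pose P : pred ('I_k * 'I_l) := fun p => dcomparable (zeta p.1) (theta p.2).
pose v (i : 'I_#|P|) : 'I_k * 'I_l := enum_val i.
have vP i : dcomparable (zeta (v i).1) (theta (v i).2).
  exact: (enum_valP i).
have vS i j : dcomparable (zeta i) (theta j) -> exists m, v m = (i, j).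
  move=> cij; have Pij : (i, j) \in P by [].
  exists (enum_rank_in Pij (i, j)); rewrite /v enum_rankK_in //.
  
have vI m m' : (v m).1 = (v m').1 -> (v m).2 = (v m').2 -> m = m'.
  move=> e1 e2; apply: enum_val_inj; rewrite -/(v m) -/(v m').
  by case: (v m) (v m') e1 e2 => ? ? [? ?] /= -> ->.
exists #|P|, (fun m => wcat (eta (v m).1) (wext (zeta (v m).1) (theta (v m).2))).
exists (fun m => wcat (xi (v m).2) (wext (theta (v m).2) (zeta (v m).1))).
split.
- apply: (refine_antichain Heta Hzeta Htheta vP _ vI) => i j /vS[m e].
  by exists m; rewrite e.
- apply: (refine_antichain (a := fun m => (v m).2) (b := fun m => (v m).1)
            Hxi Htheta Hzeta).
  + by move=> m; rewrite /dcomparable orbC; exact: vP.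
  + by move=> j i; rewrite /dcomparable orbC => /vS[m e]; exists m; rewrite e.
  + by move=> m m' e1 e2; exact: vI.
- move=> m x; have mulE y : (g * h) y = h (g y) by [].
  rewrite mulE (dcat_wcat (eta _)) gE -dcat_wcat.
  by rewrite (wext_join (vP m)) dcat_wcat hE dcat_wcat.
Qed.

Lemma higman_thompson_inv g :
  higman_thompson_set g -> higman_thompson_set g^-1.
Proof.
move=> [k [eta [zeta [Heta Hzeta gE]]]].
exists k, zeta, eta; split=> // i x.
by rewrite -gE; exact: homeoK.
Qed.

Lemma higman_thompson_one : higman_thompson_set 1.
Proof.
exists r, (fun i => (i, [::])), (fun i => (i, [::])).
have H : complete_antichain (fun i : 'I_r => (i, [::]) : dword n r).
  split=> [i j /andP[/eqP] //|[c s]].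
  by exists c; rewrite /dprefix /= eqxx prefix0s.
by split.
Qed.

Lemma higman_thompson_group : group_closed (mem higman_thompson_set).
Proof.
split; first exact/mem_set/higman_thompson_one.
move=> g h /set_mem Gg /set_mem Gh; apply/mem_set.
exact/higman_thompson_mul/higman_thompson_inv.
Qed.

Definition higman_thompson : subgroup (homeo (cantor_dot n r)) :=
  Subgroup higman_thompson_group.

End Words.

Section Transducers.
Variables n r : nat.

(* [inl c] is a dotted letter, [inr a] is a letter of X_n. *)
Definition letter : Type := ('I_r + 'I_n)%type.

Implicit Types (x : letter) (w : seq letter).

Definition undotted (s : seq 'I_n) : seq letter := [seq inr a | a <- s].

Definition dletters (v : dword n r) : seq letter := inl v.1 :: undotted v.2.

Definition stream (y : cantor n) : nat -> letter := fun k => inr (y k).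

Definition dstream (y : cantor_dot n r) : nat -> letter :=
  fun k => if k is k'.+1 then inr (y.2 k') else inl y.1.

(* The set of states is the disjoint union [tR + tS].  The functions [tnext]
   (the pi of the paper) and [tout] (the lambda of the paper) are total here,
   but only their values on the admissible pairs below are meaningful. *)
Record transducer_data := TransducerData {
  tR : finType;
  tS : countType;
  tinit : tR;
  tnext : letter -> tR + tS -> tR + tS;
  tout : letter -> tR + tS -> seq letter
}.

Definition state (A : transducer_data) : countType := (tR A + tS A)%type.

Definition q0 (A : transducer_data) : state A := inl (tinit A).

Section Data.
Variable A : transducer_data.
Implicit Types q : state A.

Definition admissible x q : bool := is_inl x == (q == q0 A).

(* Words starting with a dotted letter are read from [q0] only, words over X_n
   are read from the other states only. *)
Definition readable w q : bool :=
  if q == q0 A then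
    if w is x :: w' then is_inl x && ~~ has is_inl w' else false
  else ~~ has is_inl w.

Fixpoint next_word w q : state A :=
  if w is x :: w' then next_word w' (tnext x q) else q.

Fixpoint out_word w q : seq letter :=
  if w is x :: w' then tout x q ++ out_word w' (tnext x q) else [::].

(* The output on the infinite input [u] from [q] is the infinite word [y]: the
   outputs on the finite prefixes of [u] are prefixes of [y], of unbounded
   lengths. *)
Definition out_stream (u : nat -> letter) q (y : nat -> letter) : Prop :=
  (forall k, let o := out_word (mkseq u k) q in o = mkseq y (size o)) /\
  (forall m, exists k, m <= size (out_word (mkseq u k) q)).

Record nondegenerate : Prop := {
  tnext_neq0 : forall x q, admissible x q -> tnext x q != q0 A;
  tnext_inR : forall x q, admissible x q ->
    is_inl (tnext x q) -> is_inl q /\ tout x q = [::];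
  tnext_RS : forall x q, admissible x q ->
    is_inl q -> ~~ is_inl (tnext x q) -> exists v, tout x q = dletters v;
  tnext_inS : forall x q, admissible x q ->
    ~~ is_inl q -> ~~ is_inl (tnext x q) /\ exists s, tout x q = undotted s;
  out_cycle : forall w q, readable w q ->
    w != [::] -> next_word w q = q -> out_word w q != [::];
  out_infinite : forall (q : state A) (u : cantor n), ~~ is_inl q ->
    exists y : cantor n, out_stream (stream u) q (stream y)
}.

Definition represents (h : cantor_dot n r -> cantor_dot n r) : Prop :=
  forall y, out_stream (dstream y) (q0 A) (dstream (h y)).

Definition finite_transducer : Prop := finite_set [set: state A].

Definition synchronizing_at (m : nat) : Prop :=
  forall w, size w = m ->
    exists s : state A, forall q, readable w q -> next_word w q = s.

Definition strongly_synchronizing : Prop := exists m, synchronizing_at m.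

End Data.

Record transducer := Transducer {
  tdata :> transducer_data;
  tdataP : nondegenerate tdata
}.

Definition rational : set (homeo (cantor_dot n r)) :=
  [set h | exists A : transducer, finite_transducer A /\ represents A h].

Definition sync_representable (h : homeo (cantor_dot n r)) : Prop :=
  exists A : transducer,
    [/\ finite_transducer A, strongly_synchronizing A & represents A h].

Definition bisynchronizing : set (homeo (cantor_dot n r)) :=
  [set h | sync_representable h /\ sync_representable h^-1].

End Transducers.

Arguments rational : clear implicits.
Arguments bisynchronizing : clear implicits.

(* Main.v *)
(* Call H the normalizer of G = G_{n,r} in the group of homeomorphisms of the
   Cantor space.  The theorem follows from two facts.

   (1) Every automorphism of G is conjugation by a homeomorphism, so that
   Aut(G) = H because G has trivial centralizer.  This is Rubin's theorem: the
   disjointness of the supports of two elements can be expressed in the group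
   language, hence so can the inclusion of supports up to closure, and a point
   x corresponds under the automorphism a to the only point of the intersection
   of the closures of the supports of the a(f), where f moves x.

   (2) H consists of the homeomorphisms representable by bi-synchronizing
   transducers.  Say that h is synchronously local at level K if, for every
   word u of length K, the maps x |-> h(w u x) for all words w agree up to
   exchanging prefixes.  If h is, then conjugation by h turns a prefix
   replacement into a local prefix replacement.  Conversely, let h normalize G.
   Conjugating the elements of G that map one cone to another one shows that
   x |-> h(w u x) and x |-> h(w' u x) agree up to prefixes for all long enough
   u; for a single nonempty word w0, finitely many such pairs, namely (w0, c a)
   and (w0, w0 a) for the letters c and a, imply all the others, because the
   letters of w can be absorbed one at a time.  A level-K local homeomorphism is
   represented by the transducer whose states remember the last K letters. *)

Require Import Defs.
Set Warnings "-notation-overridden,-notation-incompatible-prefix".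
From HB Require Import structures.
From mathcomp Require Import all_boot all_classical topology.

Set Implicit Arguments.
Unset Strict Implicit.
Unset Printing Implicit Defensive.

Local Open Scope classical_set_scope.
Local Open Scope group_scope.

(** * Rubin's theorem for groups acting on compact Hausdorff spaces *)

Section Rubin.
Variables (T : topologicalType) (gT : groupType) (rho : gT -> T -> T).
Hypothesis T_hausdorff : hausdorff_space T.
Hypothesis rho_continuous : forall g, continuous (rho g).
Hypothesis rho1 : forall x, rho 1 x = x.
Hypothesis rhoM : forall g h x, rho (g * h) x = rho h (rho g x).
Hypothesis rho_faithful : forall g, (forall x, rho g x = x) -> g = 1.

Implicit Types (f g h k : gT) (x y z : T) (U V W : set T)
  (a b : Aut gT).

Definition supp g : set T := [set x | rho g x <> x].

(* The exponent is the least common multiple of the orders 1, ..., 4 that have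
   to be excluded in [alg_disjoint_supp]. *)
Hypothesis moving : forall x U, nbhs x U ->
  exists2 g, supp g `<=` U & rho (g ^+ 12) x <> x.
(** Rubin's local density condition. It enters through [image_points_unique]. *)
Hypothesis locally_dense : forall x U, nbhs x U ->
  exists W, [/\ open W, W !=set0 &
    W `<=` closure [set y | exists2 g, supp g `<=` U & rho g x = y]].

Lemma rhoK g : cancel (rho g) (rho g^-1).
Proof. by move=> x; rewrite -rhoM mulgV rho1. Qed.

Lemma rhoVK g : cancel (rho g^-1) (rho g).
Proof. by move=> x; rewrite -rhoM mulVg rho1. Qed.

Lemma rho_inj g : injective (rho g).
Proof. exact: can_inj (rhoK g). Qed.

Lemma rho_ext f g : (forall x, rho f x = rho g x) -> f = g.
Proof.
move=> e; apply/eqP; rewrite -divg_eq1; apply/eqP; apply: rho_faithful => x.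
by rewrite rhoM e rhoK.
Qed.

Lemma rhoV_fix g x : rho g x = x -> rho g^-1 x = x.
Proof. by move=> e; rewrite -{1}e rhoK. Qed.

Lemma rhoX_fix g x m : rho g x = x -> rho (g ^+ m) x = x.
Proof.
by move=> e; elim: m => [|m IH]; rewrite ?expg0 ?rho1 // expgS rhoM e.
Qed.

Lemma suppX g m : supp (g ^+ m) `<=` supp g.
Proof. by move=> x gx; apply: contra_not gx; exact: rhoX_fix. Qed.

Lemma supp_stable g x : supp g x -> supp g (rho g x).
Proof. by move=> gx; apply: contra_not gx; exact: rho_inj. Qed.

Lemma suppV g : supp g^-1 = supp g.
Proof.
apply/seteqP; split=> x gx; apply: contra_not gx; first exact: rhoV_fix.
by move/rhoV_fix; rewrite invgK.
Qed.

Lemma supp_sub_stable g U x : supp g `<=` U -> U x -> U (rho g x).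
Proof.
move=> sU Ux; have [->//|gx] := pselect (rho g x = x).
exact/sU/supp_stable.
Qed.

Lemma displaced g x : supp g x ->
  exists2 U, open_nbhs x U & forall y, U y -> ~ U (rho g y).
Proof.
move=> gx; have := T_hausdorff; rewrite open_hausdorff => /(_ (rho g x) x).
case=> [|[A B] /=]; first exact/eqP.
rewrite !inE => -[Agx Bx] [oA oB AB].
exists (B `&` rho g @^-1` A) => [|y [By Ay] [Bgy _]]; last first.
  by rewrite -[False]/((set0 : set T) (rho g y)) -AB.
split=> //; apply: openI => //.
by apply: open_comp => // y _; exact: rho_continuous.
Qed.

Lemma supp_open g : open (supp g).
Proof.
rewrite openE => x /displaced[U Ux Ug]; rewrite /interior.
apply: filterS (open_nbhs_nbhs Ux) => y Uy gy.
by apply: (Ug y Uy); rewrite gy.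
Qed.

Lemma supp_nbhs g x : supp g x -> nbhs x (supp g).
Proof. by move=> gx; apply: open_nbhs_nbhs; split=> //; exact: supp_open. Qed.

Lemma movingW x U : nbhs x U -> exists2 g, supp g `<=` U & supp g x.
Proof. by case/moving => g gU /suppX gx; exists g. Qed.

Lemma sub_closure (A B : set T) : A `<=` closure B -> closure A `<=` closure B.
Proof.
move=> /closureS.
by rewrite -((closure_id (closure B)).1 (@closed_closure _ B)).
Qed.

Lemma suppJ g h x : supp g (rho h^-1 x) -> supp (g ^ h) x.
Proof.
move=> gx e; apply: gx; apply: (rho_inj (g := h)).
by rewrite rhoVK -[RHS]e conjgE !rhoM.
Qed.

(** * Disjointness of supports in the group language *)

Definition disjoint_supp f g : Prop := forall x, supp f x -> supp g x -> False.

Lemma disjoint_suppC f g : disjoint_supp f g -> disjoint_supp g f.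
Proof. by move=> fg x gx fx; exact: (fg x). Qed.

Lemma disjoint_supp_closure f g x :
  disjoint_supp f g -> supp f x -> closure (supp g) x -> False.
Proof.
by move=> fg fx /(_ _ (supp_nbhs fx))[y [gy fy]]; exact: (fg y).
Qed.

Lemma disjoint_supp_commute f g : disjoint_supp f g -> commute f g.
Proof.
move=> fg; apply: rho_ext => x; rewrite !rhoM.
have [fx|fx] := pselect (rho f x = x).
  rewrite fx; have [gx|gx] := pselect (rho g x = x); first by rewrite gx fx.
  have [->//|fgx] := pselect (rho f (rho g x) = rho g x).
  by have := fg _ fgx (supp_stable gx).
have [->|gx] := pselect (rho g x = x); last by have := fg _ fx gx.
have [->//|gfx] := pselect (rho g (rho f x) = rho f x).
by have := fg _ (supp_stable fx) gfx.
Qed.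

(** Only commutation and commutators occur, so automorphisms preserve it. It captures disjointness
    of supports up to the twelfth power lost between [disjoint_alg] and [alg_disjoint_supp]. *)
Definition alg_disjoint g f : Prop := forall h, ~ commute f h ->
  exists f1 f2, [/\ commute f1 g, commute f2 g, [~ [~ h, f1], f2] <> 1 &
                    commute [~ [~ h, f1], f2] g].

Lemma rho_commg h f x : rho [~ h, f] x = rho f (rho h (rho f^-1 (rho h^-1 x))).
Proof. by rewrite commgEl conjgE !rhoM. Qed.

Lemma supp_outside g U x : supp g `<=` U -> ~ U x -> rho g x = x.
Proof. by move=> gU Ux; apply: contrapT => /gU. Qed.

(** Choose [U] inside [supp f] and displaced by [h], then [f1], [f2] supported in [U], with
    [supp f2] displaced by [f1]. On [U] the commutator [[~ h, f1]] acts as [f1], so its commutator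
    with [f2] is nontrivial and supported in [U], where [g] is trivial. *)
Lemma disjoint_alg f g : disjoint_supp f g -> alg_disjoint g f.
Proof.
move=> fg h fh.
have [x [fx hx]] : exists x, supp f x /\ supp h x.
  apply: contra_notP fh => nx; apply: disjoint_supp_commute => x fx hx.
  by apply: nx; exists x.
have [U0 U0x hU0] := displaced hx.
pose U := U0 `&` supp f.
have Ux : nbhs x U.
  by apply: filterI; [exact: open_nbhs_nbhs|exact: supp_nbhs].
have [f1 f1U f1x] := movingW Ux.
have [V0 V0x f1V0] := displaced f1x.
have V0x' : V0 x by exact: nbhs_singleton (open_nbhs_nbhs V0x).
have [f2 f2V f2x] := movingW (filterI Ux (open_nbhs_nbhs V0x)).
have f2U : supp f2 `<=` U by move=> y /f2V[].
have sub_commute k : supp k `<=` U -> commute k g.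
  by move=> kU; apply: disjoint_supp_commute => y /kU[_ fy]; exact: fg.
have hU y : U y -> ~ U (rho h^-1 y).
  by move=> [Uy _] [Uhy _]; apply: (hU0 _ Uhy); rewrite rhoVK.
have f1VU : supp f1^-1 `<=` U by rewrite suppV.
have f2VU : supp f2^-1 `<=` U by rewrite suppV.
set c := [~ h, f1].
have cU y : U y -> rho c y = rho f1 y.
  by move=> Uy; rewrite rho_commg (supp_outside f1VU (hU _ Uy)) rhoVK.
have cVU y : ~ U y -> ~ U (rho c^-1 y).
  move=> Uy Ucy; apply: Uy; rewrite -(rhoVK c y) (cU _ Ucy).
  exact: supp_sub_stable.
exists f1, f2; split; [exact: sub_commute|exact: sub_commute| |].
  move/eqP/commgP/(congr1 (rho^~ x)); rewrite (rhoM c f2) (rhoM f2 c).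
  have Ux' : U x by exact: nbhs_singleton.
  rewrite (cU _ Ux') (cU _ (supp_sub_stable f2U Ux')) => e.
  apply: f2x; apply: (rho_inj (g := f1)); rewrite -e.
  by apply: contrapT => /f2V[_]; exact: f1V0.
apply: sub_commute => y ky; apply: contrapT => Uy; apply: ky.
rewrite rho_commg (supp_outside f2VU (cVU _ Uy)) rhoVK.
exact: supp_outside f2U Uy.
Qed.

(* If [f] and [g ^+ 12] both move [x], take [U] around [x] disjoint from its
   images under [f], [g], ..., [g ^+ 4], and [h] supported in [U].  Then
   [~ [~ h, f1], f2] is supported in four translates of [U] by elements that
   commute with [g], while its support contains five points of a [g]-orbit. *)
Lemma alg_disjoint_supp f g : alg_disjoint g f -> disjoint_supp f (g ^+ 12).
Proof.
move=> gf x fx gx.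
have gdx d : 0 < d < 5 -> supp (g ^+ d) x.
  move=> d5 e; apply: gx; have /dvdnP[q ->] : d %| 12.
    by case: d d5 {e} => [|[|[|[|[|d]]]]].
  by rewrite mulnC expgnA; exact: rhoX_fix.
have [U [Ux fU gU]] : exists U, [/\ nbhs x U, forall y, U y -> ~ U (rho f y) &
    forall d, 0 < d < 5 -> forall y, U y -> ~ U (rho (g ^+ d) y)].
  have [U0 U0x fU0] := displaced fx.
  have [U1 U1x fU1] := displaced (gdx 1%N isT).
  have [U2 U2x fU2] := displaced (gdx 2 isT).
  have [U3 U3x fU3] := displaced (gdx 3 isT).
  have [U4 U4x fU4] := displaced (gdx 4 isT).
  exists (U0 `&` (U1 `&` (U2 `&` (U3 `&` U4)))); split.
  - repeat (apply: filterI; first exact: open_nbhs_nbhs).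
    exact: open_nbhs_nbhs.
  - by move=> y [Uy _] [/(fU0 _ Uy)].
  - case=> [|[|[|[|[|//]]]]] // _ y [_ [y1 [y2 [y3 y4]]]] [_ [z1 [z2 [z3 z4]]]].
    + exact: (fU1 y).
    + exact: (fU2 y).
    + exact: (fU3 y).
    + exact: (fU4 y).
have [h hU hx] := movingW Ux.
have [|f1 [f2 [f1g f2g k1 kg]]] := gf h.
  move/(congr1 (rho^~ x)); rewrite !rhoM => e.
  apply: hx; apply: (rho_inj (g := f)); rewrite -e.
  by apply: (supp_outside hU); apply: fU; exact: nbhs_singleton.
set c := [~ h, f1] in k1 kg; set k := [~ c, f2] in k1 kg.
have hVU : supp h^-1 `<=` U by rewrite suppV.
have cfix z : ~ U z -> ~ U (rho f1^-1 z) -> rho c z = z.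
  by move=> Uz Ufz; rewrite rho_commg (supp_outside hVU Uz)
    (supp_outside hU Ufz) rhoVK.
pose t (j : 'I_4) := nth 1 [:: 1; f1; f2; f1 * f2] j.
have suppk z : supp k z -> exists j, U (rho (t j)^-1 z).
  move=> kz; apply: contrapT => nz.
  have nzj j : ~ U (rho (t j)^-1 z) by move=> Uz; apply: nz; exists j.
  have := nzj (Ordinal (isT : 0 < 4)).
  have := nzj (Ordinal (isT : 1 < 4)).
  have := nzj (Ordinal (isT : 2 < 4)).
  have := nzj (Ordinal (isT : 3 < 4)).
  rewrite /t /= invgM rhoM invg1 rho1 => z4 z3 z2 z1; apply: kz.
  by rewrite rho_commg (rhoV_fix (cfix _ z1 z2)) (cfix _ z3 z4) rhoVK.
have [y ky] : exists y, supp k y.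
  by apply: contra_notP k1 => nk; apply: rho_faithful => y;
    apply: contrapT => ky; apply: nk; exists y.
have kgy (i : 'I_5) : supp k (rho (g ^+ i) y).
  move=> e; apply: ky; apply: (rho_inj (g := g ^+ i)); rewrite -[RHS]e -!rhoM.
  by rewrite (commuteX i kg).
pose J i := projT1 (cid (suppk _ (kgy i))).
have JU i : U (rho (t (J i))^-1 (rho (g ^+ i) y)) by rewrite /J; case: cid.
have tg j : commute (t j)^-1 g.
  apply: commute_sym; apply: commuteV.
  case: j => -[|[|[|[|//]]]] /= ?; rewrite /t /=; first exact: commute1.
  - exact: commute_sym.
  - exact: commute_sym.
  - by apply: commuteM; exact: commute_sym.
have notinj : ~ injective J.
  by move/leq_card; rewrite !card_ord.
(* Translating back by an element commuting with [g] gives a point of [U] that [g ^+ (i' - i)] keeps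
   in [U], with exponent between 1 and 4. *)
have contra (i i' : 'I_5) : i < i' -> J i = J i' -> False.
  move=> ii' e; have := JU i'; rewrite -e; have := JU i.
  have -> : nat_of_ord i' = (i + (i' - i))%N by rewrite subnKC // ltnW.
  move=> U1; rewrite expgnDr rhoM -rhoM -(commuteX _ (tg _)) rhoM.
  apply: gU => //; rewrite subn_gt0 ii' /=.
  exact: leq_ltn_trans (leq_subr _ _) (ltn_ord i').
apply: notinj => i i' e; apply: val_inj => /=.
case: (ltngtP i i') => // lt; [by case: (contra _ _ lt e)|].
by case: (contra _ _ lt (esym e)).
Qed.

Definition supp_le f g : Prop := supp f `<=` closure (supp g).

(** If [f] moves a point outside [closure (supp g)], some [h] supported near it is disjoint from [g]
    while [h ^+ 12] does not commute with [f]. The power is the one that [alg_disjoint_supp]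
    controls. *)
Lemma supp_leP f g : supp_le f g <->
  forall h, alg_disjoint h g -> commute (h ^+ 12) f.
Proof.
split=> [fg h /alg_disjoint_supp hg|fg x fx].
  apply: disjoint_supp_commute => x hx fx.
  by apply: (disjoint_supp_closure (disjoint_suppC hg) hx); exact: fg.
apply: contrapT => gx.
have [V Vx gV] : exists2 V, nbhs x V & forall y, V y -> ~ supp g y.
  move: gx; rewrite /closure /= => /existsNP[V /not_implyP[Vx VI]].
  by exists V => // y Vy gy; apply: VI; exists y.
have [U Ux fU] := displaced fx.
have [|h hUV hx] := @moving x (V `&` U).
  by apply: filterI => //; exact: open_nbhs_nbhs.
have /fg/(congr1 (rho^~ x)) : alg_disjoint h g.
  by apply: disjoint_alg => y gy /hUV[/gV]; exact.
rewrite (rhoM _ f) (rhoM f) => e.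
apply: hx; apply: (rho_inj (g := f)); rewrite e.
have h12 : supp (h ^+ 12) `<=` U by move=> y /suppX/hUV[].
apply: (supp_outside h12); apply: fU.
exact: nbhs_singleton (open_nbhs_nbhs Ux).
Qed.

(** Recovers exact disjointness, without the twelfth power: supports are open, so two that meet have
    a nontrivial element supported in their intersection. *)
Lemma disjoint_suppP f g : disjoint_supp f g <->
  forall h, supp_le h f -> supp_le h g -> h = 1.
Proof.
split=> [fg h hf hg|fg x fx gx].
  apply: rho_faithful => x; apply: contrapT => hx.
  have [y [fy hy]] := hf _ hx _ (supp_nbhs hx).
  exact: (disjoint_supp_closure fg fy (hg _ hy)).
have [h hfg hx] := movingW (filterI (supp_nbhs fx) (supp_nbhs gx)).
apply: hx; rewrite (fg h) ?rho1 // => y /hfg[fy gy]; exact: subset_closure.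
Qed.

Section Reconstruction.
Variable a : Aut gT.

Lemma aut1 : a 1 = 1.
Proof. by apply: (mulgI (a 1)); rewrite -aut_morph !mulg1. Qed.

Lemma autV g : a g^-1 = (a g)^-1.
Proof. by apply: (mulgI (a g)); rewrite -aut_morph !mulgV aut1. Qed.

Lemma autX g m : a (g ^+ m) = a g ^+ m.
Proof. by elim: m => [|m IH]; rewrite ?expg0 ?aut1 // !expgS aut_morph IH. Qed.

Lemma autJ g h : a (g ^ h) = a g ^ a h.
Proof. by rewrite !conjgE !aut_morph autV. Qed.

Lemma autR g h : a [~ g, h] = [~ a g, a h].
Proof. by rewrite !commgEl aut_morph autV autJ. Qed.

Lemma aut_inj : injective a.
Proof. exact: bij_inj (aut_bij a). Qed.

Lemma aut_commute g h : commute (a g) (a h) <-> commute g h.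
Proof.
by rewrite /commute -!aut_morph; split=> [/aut_inj|->].
Qed.

Lemma aut_surj g : exists h, a h = g.
Proof. by have [b _ bK] := aut_bij a; exists (b g); rewrite bK. Qed.

Lemma aut_alg_disjoint g f : alg_disjoint g f -> alg_disjoint (a g) (a f).
Proof.
move=> gf h'; have [h <-] := aut_surj h'.
rewrite aut_commute => /gf[f1 [f2 [c1 c2 k1 kg]]]; exists (a f1), (a f2).
rewrite -!autR; split; rewrite ?aut_commute //.
by rewrite -[X in _ <> X]aut1; move/aut_inj.
Qed.

End Reconstruction.

Lemma aut_alg_disjointE (a : Aut gT) g f :
  alg_disjoint (a g) (a f) <-> alg_disjoint g f.
Proof.
split; last exact: aut_alg_disjoint.
by move/(aut_alg_disjoint (a := aut_inv a)); rewrite !autK.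
Qed.

Lemma aut_supp_le (a : Aut gT) f g : supp_le (a f) (a g) <-> supp_le f g.
Proof.
rewrite !supp_leP; split=> fg h.
  rewrite -(aut_alg_disjointE a) => /fg.
  by rewrite -autX aut_commute.
have [k <-] := aut_surj a h.
by rewrite aut_alg_disjointE -autX aut_commute; exact: fg.
Qed.

Lemma aut_disjoint_supp (a : Aut gT) f g :
  disjoint_supp (a f) (a g) <-> disjoint_supp f g.
Proof.
rewrite !disjoint_suppP; split=> fg h.
  move=> hf hg; apply: (@aut_inj a); rewrite aut1.
  by apply: fg; rewrite aut_supp_le.
have [k <-] := aut_surj a h.
by rewrite !aut_supp_le => kf kg; rewrite (fg k) // aut1.
Qed.

(* The points [y] that can correspond to [x] under [a]. *)
Definition image_points (a : Aut gT) x : set T :=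
  [set y | forall f, supp f x -> closure (supp (a f)) y].

Hypothesis T_compact : compact [set: T].

(** The sets [closure (supp (a f))], for [f] moving [x], form a base of a proper filter, since [a]
    preserves [supp_le]; compactness gives a cluster point. *)
Lemma image_points_nonempty a x : image_points a x !=set0.
Proof.
pose D := [set f | supp f x]; pose B f := closure (supp (a f)).
have [f0 _ f0x] : exists2 f, supp f `<=` setT & supp f x.
  by apply: movingW; exact: filterT.
have FF : Filter (filter_from D B).
  apply: filter_from_filter; first by exists f0.
  move=> f g fx gx.
  have [h hfg hx] := movingW (filterI (supp_nbhs fx) (supp_nbhs gx)).
  have hle k : supp h `<=` supp k -> B h `<=` B k.
    move=> hk; have /(aut_supp_le a) : supp_le h k.
      exact: subset_trans hk (@subset_closure _ _).
    exact: sub_closure.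
  exists h => // y hy; split; apply: hle hy => z /hfg[] //.
have PF : ProperFilter (filter_from D B).
  apply: filter_from_proper => f fx.
  have [y fy] : exists y, supp (a f) y.
    apply: contrapT => n; apply: fx.
    suff -> : f = 1 by exact: rho1.
    apply: (@aut_inj a); rewrite aut1; apply: rho_faithful => y.
    by apply: contrapT => fy; apply: n; exists y.
  by exists y; exact: subset_closure.
have [|y [_ yF]] := T_compact PF; first exact: filterT.
exists y => f fx; apply: (@sub_closure (B f) (supp (a f))) => //.
by move=> V Vy; apply: yF => //; exists f.
Qed.

Lemma image_points_rho a g x y :
  image_points a x y -> image_points a (rho g x) (rho (a g) y).
Proof.
move=> xy f fgx V Vy.
have := @suppJ f g^-1 x; rewrite invgK => /(_ fgx)/xy.
move=> /(_ (rho (a g) @^-1` V))[|z [fz Vz]]; first exact: rho_continuous.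
exists (rho (a g) z); split=> // e; apply: fz.
by rewrite autJ autV conjgE !rhoM invgK e rhoK.
Qed.

Lemma image_points_supp a x y e :
  image_points a x y -> supp (a e) y -> closure (supp e) x.
Proof.
move=> xy ey V Vx; apply: contrapT => eV.
have [f fV fx] := movingW Vx.
have /(aut_disjoint_supp a) fe : disjoint_supp f e.
  by move=> z /fV Vz ez; apply: eV; exists z.
exact: disjoint_supp_closure (disjoint_suppC fe) ey (xy _ fx).
Qed.

Lemma separated x y : x <> y -> exists U V,
  [/\ nbhs x U, nbhs y V & forall z, U z -> ~ V z].
Proof.
move=> /eqP xy; have := T_hausdorff; rewrite open_hausdorff => /(_ _ _ xy).
case=> -[A B] /=; rewrite !inE => -[Ax By] [oA oB AB].
exists A, B; split; [exact: open_nbhs_nbhs|exact: open_nbhs_nbhs|].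
by move=> z Az Bz; rewrite -[False]/((set0 : set T) z) -AB.
Qed.

(** A second image point would make a whole open set [W] consist of image points of [x]. A
    nontrivial element supported in [W] would then come from one moving no point but [x], and no
    support is a single point. *)
Lemma image_points_unique a x y y' :
  image_points a x y -> image_points a x y' -> y = y'.
Proof.
move=> xy xy'; apply: contrapT => /separated[A [B [Ay By' AB]]].
have [f' f'B f'y'] := movingW By'.
have [e ef'] := aut_surj a f'.
have ex : closure (supp e) x by apply: image_points_supp xy' _; rewrite ef'.
have [W [oW [w Ww] WA]] := locally_dense Ay.
(* An element supported in [A] comes from a [k0] with support disjoint from that of [e]. As [x] is
   in [closure (supp e)], [k0] fixes [x], and equivariance yields another image point of [x]. *)
have Wx : W `<=` image_points a x.
  apply: subset_trans WA _ => z zA f fx.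
  move: z zA; apply: sub_closure => _ [k kA <-].
  have [k0 k0k] := aut_surj a k.
  suff k0x : rho k0 x = x.
    by have := @image_points_rho a k0 _ _ xy; rewrite k0x k0k; exact.
  have /(aut_disjoint_supp a) k0e : disjoint_supp (a k0) (a e).
    by rewrite k0k ef' => z /kA Az /f'B; exact: AB.
  apply: contrapT => k0x.
  exact: disjoint_supp_closure k0e k0x ex.
have [t tW tw] : exists2 t, supp t `<=` W & supp t w.
  by apply: movingW; exact: open_nbhs_nbhs.
have [t0 t0t] := aut_surj a t.
have t0x z : supp t0 z -> z = x.
  move=> t0z; apply: contrapT => /separated[A' [B' [A'z B'x A'B']]].
  have [f fB' fx] := movingW B'x.
  have /(aut_supp_le a) : supp_le (a t0) (a f).
    by rewrite t0t => v /tW/Wx; apply.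
  by move/(_ _ t0z _ A'z) => [v [/fB' B'v /A'B']].
have [z t0z] : exists z, supp t0 z.
  apply: contrapT => n; apply: tw; rewrite -t0t.
  suff -> : t0 = 1 by rewrite aut1 rho1.
  by apply: rho_faithful => z; apply: contrapT => t0z; apply: n; exists z.
apply: (t0z).
by rewrite (t0x _ t0z) -[in LHS](t0x _ t0z) (t0x _ (supp_stable t0z)).
Qed.

(** An element supported away from [x] fixes [x], hence [tau x], although it can be chosen to move
    [tau x]. Here [tau] is any map, so composites of spatial maps qualify before their continuity is
    known. *)
Lemma centralizer_trivial (tau : T -> T) :
  (forall g x, tau (rho g x) = rho g (tau x)) -> forall x, tau x = x.
Proof.
move=> tauM x; apply: contrapT => /separated[A [B [Ax Bx AB]]].
have [g gA gx] := movingW Ax; apply: gx.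
rewrite -tauM (supp_outside gA) // => Axx; apply: (AB x Axx).
exact: nbhs_singleton.
Qed.

Definition spatial_map a x : T := projT1 (cid (image_points_nonempty a x)).

Lemma spatial_mapP a x : image_points a x (spatial_map a x).
Proof. by rewrite /spatial_map; case: cid. Qed.

Lemma spatial_map_rho a g x :
  spatial_map a (rho g x) = rho (a g) (spatial_map a x).
Proof.
apply: (@image_points_unique a (rho g x)); first exact: spatial_mapP.
by apply: image_points_rho; exact: spatial_mapP.
Qed.

Lemma spatial_map_can (a b : Aut gT) :
  cancel a b -> cancel (spatial_map a) (spatial_map b).
Proof.
move=> ab x.
apply: (centralizer_trivial (tau := spatial_map b \o spatial_map a)).
by move=> g z /=; rewrite !spatial_map_rho ab.
Qed.

(** Supports form a base of the topology, and the preimage of [supp (a f)] is [supp f]. *)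
Lemma spatial_map_continuous (a : Aut gT) : continuous (spatial_map a).
Proof.
move=> x V Vx; have [f' f'V f'x] := movingW Vx.
have [f ff'] := aut_surj a f'.
have inj : injective (spatial_map a).
  exact: can_inj (spatial_map_can (@autK _ a)).
have fE z : supp f z <-> supp f' (spatial_map a z).
  by rewrite /supp /= -ff' -spatial_map_rho; split=> [fz /inj|fz e]; 
    [|apply: fz; rewrite e].
by apply: filterS (supp_nbhs ((fE x).2 f'x)) => z /fE/f'V.
Qed.

(* Rubin's reconstruction theorem, by the argument of Belk, Elliott and
   Matte Bon. *)
Theorem rubin (a : Aut gT) :
  exists phi : homeo T, forall g x, phi (rho g x) = rho (a g) (phi x).
Proof.
have aP : continuous (spatial_map a) /\ exists psi : T -> T,
    [/\ cancel (spatial_map a) psi, cancel psi (spatial_map a) & continuous psi].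
  split; first exact: spatial_map_continuous.
  exists (spatial_map (aut_inv a)); split.
  - by apply: spatial_map_can; exact: autK.
  - by apply: spatial_map_can; exact: autVK.
  - exact: spatial_map_continuous.
by exists (Homeo aP) => g x /=; exact: spatial_map_rho.
Qed.

End Rubin.

(** * Cones and prefix replacements *)

Section Cones.
Variables n r : nat.
Local Notation X := (cantor_dot n r).
Implicit Types (x : cantor n) (y z : X) (w v : dword n r) (s : seq 'I_n).

Definition pre k y : dword n r := (y.1, mkseq y.2 k).
Definition tail k y : cantor n := fun i => y.2 (k + i)%N.

Lemma prepend_lt s x i a : i < size s -> prepend s x i = nth a s i.
Proof. by move=> si; rewrite /prepend si; exact: set_nth_default. Qed.

Lemma prepend_ge s x i : prepend s x (size s + i)%N = x i.
Proof. by rewrite /prepend ltnNge leq_addr addKn. Qed.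

Lemma prepend_inj s : injective (prepend s).
Proof.
by move=> x x' e; apply/funext => i; rewrite -(prepend_ge s x) e prepend_ge.
Qed.

Lemma dcat_inj w : injective (dcat w).
Proof. by move=> x x' [/prepend_inj]. Qed.

Lemma preP k y z :
  pre k y = pre k z <-> y.1 = z.1 /\ forall i, i < k -> y.2 i = z.2 i.
Proof.
split=> [[e1 e2]|[e1 e2]].
  split=> // i ik; have := congr1 (fun s => nth (y.2 i) s i) e2.
  by rewrite !nth_mkseq.
by rewrite /pre e1; congr pair; apply/eq_in_map => i; rewrite mem_iota => /e2.
Qed.

Lemma pre_leq j k y z : j <= k -> pre k y = pre k z -> pre j y = pre j z.
Proof.
move=> jk /preP[e1 e2]; apply/preP; split=> // i ij; apply: e2.
exact: leq_trans ij jk.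
Qed.

Lemma pre_ext y z : (forall k, pre k y = pre k z) -> y = z.
Proof.
move=> e; have /preP[e1 _] := e 0.
rewrite [y]surjective_pairing [z]surjective_pairing.
by congr pair => //; apply/funext => i; have /preP[_ ->] := e i.+1.
Qed.

Lemma dcat_pre k y : dcat (pre k y) (tail k y) = y.
Proof.
rewrite [RHS]surjective_pairing; congr pair; apply/funext => i /=.
have [ik|ki] := ltnP i k.
  by rewrite (@prepend_lt _ _ _ (y.2 i)) ?size_mkseq // nth_mkseq.
have iE : i = (size (mkseq y.2 k) + (i - k))%N by rewrite size_mkseq subnKC.
by rewrite {1}iE prepend_ge /tail subnKC.
Qed.

Lemma pre_dcat w x : pre (size w.2) (dcat w x) = w.
Proof.
rewrite [RHS]surjective_pairing; congr pair.
apply: (@eq_from_nth _ (x 0)); rewrite size_mkseq // => i iw.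
by rewrite nth_mkseq //; exact: prepend_lt.
Qed.

Lemma tail_dcat w x : tail (size w.2) (dcat w x) = x.
Proof. by apply/funext => i; exact: prepend_ge. Qed.

Lemma size_pre k y : size (pre k y).2 = k.
Proof. exact: size_mkseq. Qed.

Lemma pre_wcat j k y : j <= k ->
  pre k y = wcat (pre j y) (mkseq (tail j y) (k - j)).
Proof.
move=> jk; rewrite /wcat /pre /= -[in LHS](subnKC jk) /mkseq iotaD map_cat.
rewrite add0n; congr (_, _ ++ _).
by rewrite -[X in iota X _]addn0 iotaDl -map_comp.
Qed.

Lemma dcat_eq w v x x' : size w.2 <= size v.2 -> dcat w x = dcat v x' ->
  exists2 s, v = wcat w s & x = prepend s x'.
Proof.
move=> wv e; have := pre_dcat v x'.
rewrite -e (pre_wcat _ wv) pre_dcat tail_dcat.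
move=> vE; exists (mkseq x (size v.2 - size w.2)) => //.
by move: e; rewrite -[in X in _ = X -> _]vE dcat_wcat => /dcat_inj.
Qed.

Lemma pre_dcat_congr k w x x' : (forall i, i < k -> x i = x' i) ->
  pre (size w.2 + k) (dcat w x) = pre (size w.2 + k) (dcat w x').
Proof.
move=> e; apply/preP; split=> // i ik /=.
have [iw|wi] := ltnP i (size w.2); first by rewrite !(@prepend_lt _ _ _ (x 0)).
by rewrite -(subnKC wi) !prepend_ge; apply: e; rewrite ltn_subLR.
Qed.

Lemma cantor_cone_nbhs x k :
  nbhs x [set x' : cantor n | forall i, i < k -> x' i = x i].
Proof.
elim: k => [|k IH]; first by apply: filterS filterT => x' _ i.
have xk : nbhs x [set x' : cantor n | x' k = x k].
  have : nbhs (proj k x) [set a : discrete_topology 'I_n | a = x k].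
    by rewrite nbhs_principalE.
  by move/(@proj_continuous _ (fun=> discrete_topology 'I_n) k x).
apply: filterS (filterI IH xk) => x' [e ek] i.
by rewrite ltnS leq_eqVlt => /predU1P[->|/e].
Qed.

Lemma cantor_nbhs_cone x (A : set (cantor n)) : nbhs x A ->
  exists k, forall x', (forall i, i < k -> x' i = x i) -> A x'.
Proof.
pose B k := [set x' : cantor n | forall i, i < k -> x' i = x i].
have FF : Filter (filter_from setT B).
  apply: filter_from_filter; first by exists 0.
  move=> i j _ _; exists (maxn i j) => // x' e; split=> l li; apply: e.
    exact: leq_trans li (leq_maxl _ _).
  exact: leq_trans li (leq_maxr _ _).
(* The product topology is a supremum over the coordinates, so convergence of the filter of cones is
   checked one coordinate at a time. *)
suff : filter_from setT B --> x by move=> h /h[k _ kA]; exists k.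
apply/cvg_sup => i A' /= [_ [[C oC <-] Cx] CA].
by exists i.+1 => // x' e; apply: CA => /=; rewrite e.
Qed.

Lemma nbhs_cone y (A : set X) :
  nbhs y A <-> exists k, forall z, pre k z = pre k y -> A z.
Proof.
split=> [[[P Q] /= [Py Qy] PQ]|[k kA]].
  have [k kQ] := cantor_nbhs_cone Qy; exists k => z /preP[e1 e2].
  apply: PQ; split=> /=; last by apply: kQ => i /e2.
  by rewrite e1; exact: nbhs_singleton Py.
exists ([set c | c = y.1], [set x | forall i, i < k -> x i = y.2 i]).
  split; last exact: cantor_cone_nbhs.
  by rewrite /= nbhs_principalE.
by move=> z [/= e1 e2]; apply: kA; apply/preP.
Qed.

Lemma cone_nbhs k y : nbhs y [set z | pre k z = pre k y].
Proof. by apply/nbhs_cone; exists k. Qed.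

Lemma continuous_cone (f : X -> X) : continuous f <->
  forall y k, exists l, forall z, pre l z = pre l y -> pre k (f z) = pre k (f y).
Proof.
split=> cf y.
  by move=> k; have /nbhs_cone := cf y _ (cone_nbhs k (f y)).
move=> A /nbhs_cone[k kA]; have [l lk] := cf y k.
by apply/nbhs_cone; exists l => z /lk/kA.
Qed.

Lemma cantor_dot_hausdorff : hausdorff_space X.
Proof.
move=> y z yz; apply: pre_ext => k.
by have [u [/= <- <-]] := yz _ _ (cone_nbhs k y) (cone_nbhs k z).
Qed.

Lemma cantor_dot_compact : compact [set: X].
Proof.
rewrite -setXTT; apply: compact_setX.
  by apply: finite_compact; exact: (@finite_finset 'I_r).
have := @tychonoff nat (fun=> discrete_topology 'I_n) (fun=> setT).
have -> : [set f : forall _ : nat, discrete_topology 'I_n |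
    forall i, setT (f i)] = setT.
  by apply/seteqP; split.
by apply=> i; apply: finite_compact; exact: (@finite_finset 'I_n).
Qed.

(** If every level [k] had a bad point [u k], a cluster point [y] would have a good prefix at some
    level, shared by some [u j] with [j] beyond that level. *)
Lemma uniform_level (P : dword n r -> Prop) :
  (forall w s, P w -> P (wcat w s)) -> (forall y, exists k, P (pre k y)) ->
  exists k, forall y, P (pre k y).
Proof.
move=> Pcat Ppre; apply: contrapT => /forallNP nP.
have /choice[u uP] k : exists y, ~ P (pre k y).
  by apply/existsNP; exact: nP.
have [|y [_ yu]] := @cantor_dot_compact (u @ \oo) _; first exact: filterT.
have [k Pk] := Ppre y.
have ku : (u @ \oo) [set z | exists2 j, k <= j & z = u j].
  by exists k => // j /= kj; exists j.
have [z [[j kj ->] /= e]] := yu _ _ ku (cone_nbhs k y).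
by apply: (uP j); rewrite (pre_wcat _ kj) e; exact: Pcat.
Qed.

(** A local criterion for membership in the Higman-Thompson group, free of antichains. *)
Definition prefix_replacing (f : X -> X) : Prop :=
  forall y, exists k v, forall x, f (dcat (pre k y) x) = dcat v x.

Lemma prefix_replacing_continuous f : prefix_replacing f -> continuous f.
Proof.
move=> fP; apply/continuous_cone => y k.
have [l [v fv]] := fP y; exists (l + k)%N => z zy.
have zl : pre l z = pre l y by apply: pre_leq zy; exact: leq_addr.
rewrite -(dcat_pre l z) -(dcat_pre l y) zl !fv.
apply: (@pre_leq _ (size v.2 + k)); first exact: leq_addl.
apply: pre_dcat_congr => i ik; have /preP[_] := zy; apply.
by rewrite ltn_add2l.
Qed.

Lemma higman_thompson_prefix_replacing (g : homeo X) :
  higman_thompson_set g -> prefix_replacing g.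
Proof.
move=> [k [eta [zeta [[_ etaC] _ gE]]]] y.
pose K := \max_i size (eta i).2.
have [i iy] := etaC (pre K y).
have iK : size (eta i).2 <= K by exact: (leq_bigmax i).
exists K; case/orP: iy => [/dprefixP[s e]|/dprefixP[s e]].
  by exists (wcat (zeta i) s) => x; rewrite e !dcat_wcat gE.
have s0 : s = [::].
  apply/size0nil; move: iK; rewrite e size_cat size_pre.
  by case: (size s) => // m; rewrite addnS ltnNge leq_addr.
by exists (zeta i) => x; rewrite -gE e s0 wcatw0.
Qed.

Lemma complete_antichain_partition (I : finType) (xi : I -> dword n r) :
  0 < n -> (forall y, exists i x, y = dcat (xi i) x) ->
  (forall i j x x', dcat (xi i) x = dcat (xi j) x' -> i = j) ->
  complete_antichain xi.
Proof.
move=> n0 cover disj; pose x0 : cantor n := fun=> Ordinal n0; split.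
  move=> i j /dprefixP[s e]; apply: (disj _ _ (prepend s x0) x0).
  by rewrite e dcat_wcat.
move=> w; have [i [x e]] := cover (dcat w x0); exists i.
case/orP: (leq_total (size (xi i).2) (size w.2)) => le.
  have [s -> _] := dcat_eq le (esym e); by rewrite dprefix_wcat.
have [s -> _] := dcat_eq le e; by rewrite dprefix_wcat orbT.
Qed.

(** Compactness gives one level [K] for all points. The words with [K] undotted letters form the
    source antichain; the cones of their images form a partition because [g] is a bijection. *)
Lemma prefix_replacing_higman_thompson (g : homeo X) :
  0 < n -> prefix_replacing g -> higman_thompson_set g.
Proof.
move=> n0 gP; pose x0 : cantor n := fun=> Ordinal n0.
have [K KP] : exists K, forall y,
    exists v, forall x, g (dcat (pre K y) x) = dcat v x.
  pose P w := exists v, forall x, g (dcat w x) = dcat v x.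
  apply: (uniform_level (P := P)) => //.
  by move=> w s [v vP]; exists (wcat v s) => x; rewrite !dcat_wcat.
have g_inj : injective g by exact: can_inj (homeoK g).
pose I : finType := ('I_r * K.-tuple 'I_n)%type.
pose eta (i : I) : dword n r := (i.1, tval i.2).
have eta_cover y : exists i x, y = dcat (eta i) x.
  exists (y.1, [tuple of mkseq y.2 K]), (tail K y).
  by rewrite -[LHS](dcat_pre K).
have eta_pre i x : pre K (dcat (eta i) x) = eta i.
  by have := pre_dcat (eta i) x; rewrite size_tuple.
have eta_disj i j x x' : dcat (eta i) x = dcat (eta j) x' -> i = j.
  move/(congr1 (pre K)); rewrite !eta_pre => -[].
  by case: i j => c t [d u] /= -> /val_inj ->.
have /choice[zeta zetaP] (i : I) :
    exists v, forall x, g (dcat (eta i) x) = dcat v x.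
  by rewrite -(eta_pre i x0); exact: KP.
exists #|I|, (eta \o enum_val), (zeta \o enum_val); split.
- apply: complete_antichain_partition => //.
    move=> y; have [i [x ->]] := eta_cover y.
    by exists (enum_rank i), x; rewrite /= enum_rankK.
  by move=> i j x x' /eta_disj/enum_val_inj.
- apply: complete_antichain_partition => //.
    move=> y; have [i [x e]] := eta_cover (homeo_inv g y).
    by exists (enum_rank i), x; rewrite /= enum_rankK -zetaP -e homeoVK.
  by move=> i j x x' /=; rewrite -!zetaP => /g_inj/eta_disj/enum_val_inj.
- by move=> i x; exact: zetaP.
Qed.

(** * Exchanging two disjoint cones *)

Section Swap.
Variables w v : dword n r.
Hypothesis wv : ~~ dcomparable w v.

Definition swap_fun y : X :=
  if pre (size w.2) y == w :> 'I_r * seq 'I_n then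
    dcat v (tail (size w.2) y)
  else if pre (size v.2) y == v :> 'I_r * seq 'I_n then
    dcat w (tail (size v.2) y)
  else y.

Lemma swap_funl x : swap_fun (dcat w x) = dcat v x.
Proof. by rewrite /swap_fun pre_dcat eqxx tail_dcat. Qed.

Lemma incomparable_dcat x x' : dcat w x <> dcat v x'.
Proof.
move=> e; move/negP: wv; apply; rewrite /dcomparable.
case/orP: (leq_total (size w.2) (size v.2)) => le.
  by have [s -> _] := dcat_eq le e; rewrite dprefix_wcat.
by have [s -> _] := dcat_eq le (esym e); rewrite dprefix_wcat orbT.
Qed.

Lemma swap_funr x : swap_fun (dcat v x) = dcat w x.
Proof.
rewrite /swap_fun; case: eqP => [e|_]; last by rewrite pre_dcat eqxx tail_dcat.
by case: (@incomparable_dcat (tail (size w.2) (dcat v x)) x);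
  rewrite -{1}e dcat_pre.
Qed.

Lemma swap_fun_out y : pre (size w.2) y <> w -> pre (size v.2) y <> v ->
  swap_fun y = y.
Proof. by move=> /eqP/negbTE h1 /eqP/negbTE h2; rewrite /swap_fun h1 h2. Qed.

Lemma swap_fun_cases y : [\/ exists x, y = dcat w x, exists x, y = dcat v x |
  pre (size w.2) y <> w /\ pre (size v.2) y <> v].
Proof.
have [e|nw] := pselect (pre (size w.2) y = w).
  by constructor 1; exists (tail (size w.2) y); rewrite -{1}e dcat_pre.
have [e|nv] := pselect (pre (size v.2) y = v); last by constructor 3.
by constructor 2; exists (tail (size v.2) y); rewrite -{1}e dcat_pre.
Qed.

Lemma swap_funK : involutive swap_fun.
Proof.
move=> y; have [[x ->]|[x ->]|[h1 h2]] := swap_fun_cases y.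
- by rewrite swap_funl swap_funr.
- by rewrite swap_funr swap_funl.
- by rewrite !swap_fun_out.
Qed.

Lemma swap_fun_prefix_replacing : prefix_replacing swap_fun.
Proof.
move=> y; have [[x ->]|[x ->]|[h1 h2]] := swap_fun_cases y.
- by exists (size w.2), v => x'; rewrite pre_dcat swap_funl.
- by exists (size v.2), w => x'; rewrite pre_dcat swap_funr.
pose k := maxn (size w.2) (size v.2); exists k, (pre k y) => x.
have e := pre_dcat (pre k y) x; rewrite size_pre in e.
have ew := pre_leq (leq_maxl _ _ : size w.2 <= k) e.
have ev := pre_leq (leq_maxr _ _ : size v.2 <= k) e.
by apply: swap_fun_out; rewrite ?ew ?ev.
Qed.

Fact swap_subproof : continuous swap_fun /\
  exists g : X -> X, [/\ cancel swap_fun g, cancel g swap_fun & continuous g].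
Proof.
have c := prefix_replacing_continuous swap_fun_prefix_replacing.
by split=> //; exists swap_fun; split=> //; exact: swap_funK.
Qed.

Definition swap : homeo X := Homeo swap_subproof.

End Swap.

End Cones.

(** * Automorphisms of the Higman-Thompson group *)

Section HigmanThompson.
Variables n r : nat.
Hypothesis n_gt1 : 1 < n.
Local Notation X := (cantor_dot n r).
Local Notation G := (subgroup_type (higman_thompson n r)).
Implicit Types (x : cantor n) (y z : X) (w v : dword n r) (s : seq 'I_n).

Let n_gt0 : 0 < n := ltnW n_gt1.

Definition ht_act (g : G) y : X := (\val g : homeo X) y.

Lemma ht_act1 y : ht_act 1 y = y. Proof. by []. Qed.

Lemma ht_actM (g h : G) y : ht_act (g * h) y = ht_act h (ht_act g y).
Proof. by []. Qed.

Lemma ht_act_continuous (g : G) : continuous (ht_act g).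
Proof. by have [] := homeoP (\val g : homeo X). Qed.

Lemma ht_act_faithful (g : G) : (forall y, ht_act g y = y) -> g = 1.
Proof. by move=> e; apply: val_inj; apply: homeo_ext. Qed.

Lemma higman_thompson_elt (g : homeo X) :
  prefix_replacing g -> exists g' : G, forall y, ht_act g' y = g y.
Proof.
move=> gP; have /mem_set Gg := prefix_replacing_higman_thompson n_gt0 gP.
by exists (exist _ g Gg).
Qed.

Lemma swap_elt w v : ~~ dcomparable w v ->
  exists g : G, [/\ forall x, ht_act g (dcat w x) = dcat v x,
    forall x, ht_act g (dcat v x) = dcat w x &
    forall y, pre (size w.2) y <> w -> pre (size v.2) y <> v -> ht_act g y = y].
Proof.
move=> wv; have [|g gE] := @higman_thompson_elt (swap wv).
  exact: swap_fun_prefix_replacing.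
exists g; split=> [x|x|y]; rewrite gE /=.
- exact: swap_funl.
- exact: swap_funr.
- exact: swap_fun_out.
Qed.

Lemma incomparable_size w v : size w.2 = size v.2 -> w <> v ->
  ~~ dcomparable w v.
Proof.
move=> sz wv; apply/negP => /orP[] /dprefixP[s e]; apply: wv.
  move: sz; rewrite e size_cat -[LHS]addn0 => /addnI/esym/size0nil ->.
  by rewrite wcatw0.
move: sz; rewrite e size_cat -[RHS]addn0 => /addnI/size0nil ->.
by rewrite wcatw0.
Qed.

Lemma wcatI w : injective (wcat w).
Proof.
by move=> s t [] /(congr1 (drop (size w.2))); rewrite !drop_size_cat.
Qed.

(** The cycle is the product, acting on the right, of the transpositions (0 1), (0 2), (0 3), (0 4).
    Its length is coprime to the exponent 12 of [ht_moving]. *)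
Lemma five_cycle (W : 'I_5 -> dword n r) :
  (forall i j, i != j -> ~~ dcomparable (W i) (W j)) ->
  exists g : G, (forall i x, ht_act g (dcat (W i) x) = dcat (W (ordS i)) x) /\
    (forall y, (forall i, pre (size (W i).2) y <> W i) -> ht_act g y = y).
Proof.
move=> WP.
have Wout i j x : i != j -> pre (size (W i).2) (dcat (W j) x) <> W i.
  move=> ij e; have := dcat_pre (size (W i).2) (dcat (W j) x); rewrite e.
  exact: incomparable_dcat (WP _ _ ij) _ _.
have sP j : exists g : G, j != ord0 -> [/\
    forall x, ht_act g (dcat (W ord0) x) = dcat (W j) x,
    forall x, ht_act g (dcat (W j) x) = dcat (W ord0) x &
    (forall y, pre (size (W ord0).2) y <> W ord0 ->
      pre (size (W j).2) y <> W j -> ht_act g y = y)].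
  case: (eqVneq j ord0) => [_|j0]; first by exists 1.
  have [|g gP] := @swap_elt (W ord0) (W j); first by apply: WP; rewrite eq_sym.
  by exists g.
have /choice[s sE] := sP.
have sfix i j x : i != j -> i != ord0 -> j != ord0 ->
    ht_act (s j) (dcat (W i) x) = dcat (W i) x.
  by move=> ij i0 j0; have [_ _] := sE _ j0; apply; apply: Wout; rewrite eq_sym.
pose i1 : 'I_5 := Ordinal (isT : 1 < 5).
pose i2 : 'I_5 := Ordinal (isT : 2 < 5).
pose i3 : 'I_5 := Ordinal (isT : 3 < 5).
pose i4 : 'I_5 := Ordinal (isT : 4 < 5).
have [a1 b1 c1] := sE i1 isT; have [a2 b2 c2] := sE i2 isT.
have [a3 b3 c3] := sE i3 isT; have [a4 b4 c4] := sE i4 isT.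
exists (s i1 * s i2 * s i3 * s i4); split=> [i x|y Wy]; last first.
  by rewrite !ht_actM c1 ?c2 ?c3 ?c4.
rewrite !ht_actM; case: i => -[|[|[|[|[|//]]]]] i5.
- rewrite (val_inj _ : Ordinal i5 = ord0) // a1 !sfix //.
  by congr (dcat (W _) x); exact: val_inj.
- rewrite (val_inj _ : Ordinal i5 = i1) // b1 a2 !sfix //.
  by congr (dcat (W _) x); exact: val_inj.
- rewrite (val_inj _ : Ordinal i5 = i2) // (sfix i2 i1) // b2 a3 !sfix //.
  by congr (dcat (W _) x); exact: val_inj.
- rewrite (val_inj _ : Ordinal i5 = i3) //.
  rewrite (sfix i3 i1) // (sfix i3 i2) // b3 a4.
  by congr (dcat (W _) x); exact: val_inj.
- rewrite (val_inj _ : Ordinal i5 = i4) //.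
  rewrite (sfix i4 i1) // (sfix i4 i2) // (sfix i4 i3) // b4.
  by congr (dcat (W _) x); exact: val_inj.
Qed.

Lemma pre_dprefix w v y :
  dprefix w v -> pre (size v.2) y = v -> pre (size w.2) y = w.
Proof.
move=> /dprefixP[s ->] e; rewrite -(dcat_pre (size (wcat w s).2) y) e dcat_wcat.
exact: pre_dcat.
Qed.

Lemma ht_moving y (U : set X) : nbhs y U ->
  exists2 g : G, supp ht_act g `<=` U & ht_act (g ^+ 12) y <> y.
Proof.
case/nbhs_cone => k kU.
(* Three more letters give [n ^ 3], at least 8, extensions, enough for five incomparable words. [t0]
   comes first so that [y] lies in the cone of [W ord0]. *)
pose t0 : 3.-tuple 'I_n := [tuple of mkseq (tail k y) 3].
pose ts := t0 :: rem t0 (enum {: 3.-tuple 'I_n}).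
have ts_uniq : uniq ts.
  by rewrite /= mem_rem_uniq ?enum_uniq //= inE eqxx rem_uniq ?enum_uniq.
have ts_size : 5 <= size ts.
  rewrite /= size_rem ?mem_enum // -cardE card_tuple card_ord.
  have : (2 ^ 3 <= n ^ 3)%N by rewrite leq_exp2r.
  by case: (n ^ 3)%N => // m; exact: leq_trans.
pose W (i : 'I_5) := wcat (pre k y) (nth t0 ts i).
have [i j ij|g [gW gout]] := @five_cycle W.
  apply: incomparable_size; first by rewrite !size_cat !size_tuple.
  move/wcatI/val_inj/eqP; rewrite nth_uniq //; first exact/negP.
  - exact: leq_trans (ltn_ord i) ts_size.
  - exact: leq_trans (ltn_ord j) ts_size.
exists g.
  move=> z gz; apply: kU; apply: contrapT => kz; apply: gz; apply: gout => i.
  move/(pre_dprefix (dprefix_wcat _ _)); rewrite size_pre; exact: kz.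
have yE : y = dcat (W ord0) (tail (k + 3) y).
  rewrite -[LHS](dcat_pre (k + 3)) (pre_wcat _ (leq_addr 3 k)).
  by rewrite addKn.
have gX m :
    ht_act (g ^+ m) y = dcat (W (iter m (@ordS 5) ord0)) (tail (k + 3) y).
  elim: m => [|m IH]; first by rewrite expg0 ht_act1.
  by rewrite expgSr ht_actM IH gW.
(* As 12 is 2 modulo 5, [g ^+ 12] sends the cone of index 0 to the cone of index 2. *)
rewrite gX {2}yE => /(congr1 (pre (k + 3))).
have preW i : pre (k + 3) (dcat (W i) (tail (k + 3) y)) = W i.
  by rewrite -[RHS](pre_dcat _ (tail (k + 3) y)) size_cat size_pre size_tuple.
rewrite !preW => /wcatI/val_inj/eqP; rewrite nth_uniq //.
exact: leq_trans ts_size.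
Qed.

(** The orbit is dense in the whole cone of [pre k y]: exchanging two small cones inside it carries
    [y] close to any given [z]. *)
Lemma ht_locally_dense y (U : set X) : nbhs y U ->
  exists W, [/\ open W, W !=set0 &
    W `<=` closure
      [set z | exists2 g : G, supp ht_act g `<=` U & ht_act g y = z]].
Proof.
case/nbhs_cone => k kU; exists [set z | pre k z = pre k y]; split.
- rewrite openE => z /= zy; apply/nbhs_cone; exists k => u.
  by rewrite zy.
- by exists y.
move=> z zy V /nbhs_cone[l lV].
pose L := maxn k l.
have [e|ne] := pselect (pre L y = pre L z).
  exists y; split.
    by exists 1 => // u; rewrite /supp /= ht_act1.
  by apply: lV; apply: pre_leq e; exact: leq_maxr.
have [|g [gl gr gout]] := @swap_elt (pre L y) (pre L z).
  by apply: incomparable_size; rewrite ?size_pre.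
exists (ht_act g y); split; last first.
  rewrite -{1}(dcat_pre L y) gl; apply: lV.
  apply: (@pre_leq _ _ _ L); first exact: leq_maxr.
  by have := pre_dcat (pre L z) (tail L y); rewrite size_pre.
exists g => // u gu; apply: kU; apply: contrapT => uk; apply: gu.
apply: gout; rewrite size_pre => /(pre_leq (leq_maxl _ _ : k <= L)) //.
by rewrite zy.
Qed.

Theorem higman_thompson_rubin (a : Aut G) :
  exists phi : homeo X, forall g y, phi (ht_act g y) = ht_act (a g) (phi y).
Proof.
apply: rubin.
- exact: cantor_dot_hausdorff.
- exact: ht_act_continuous.
- exact: ht_act1.
- exact: ht_actM.
- exact: ht_act_faithful.
- exact: ht_moving.
- exact: ht_locally_dense.
- exact: cantor_dot_compact.
Qed.

Lemma higman_thompson_centralizer (tau : X -> X) :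
  (forall g y, tau (ht_act g y) = ht_act g (tau y)) -> forall y, tau y = y.
Proof.
apply: centralizer_trivial.
- exact: cantor_dot_hausdorff.
- exact: ht_act1.
- exact: ht_actM.
- exact: ht_moving.
Qed.

End HigmanThompson.

(** * Normalizing homeomorphisms act locally *)

Section LocalActions.
Variables n r : nat.
Local Notation X := (cantor_dot n r).
Implicit Types (x : cantor n) (y z : X) (w v : dword n r) (s u : seq 'I_n).

Definition sync_local (h : X -> X) K (psi : seq 'I_n -> cantor n -> cantor n) :=
  forall u, size u = K -> forall w, exists v, forall x,
    h (dcat (wcat w u) x) = dcat v (psi u x).

Lemma homeo_continuous (h : homeo X) : continuous h.
Proof. by have [] := homeoP h. Qed.

Lemma conjg_homeo (g h : homeo X) y : (g ^ h) y = h (g (homeo_inv h y)).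
Proof. by rewrite conjgE. Qed.

(** Near the preimage [z] of [y], [g] replaces [pre k z] by [v]. Since [h] acts below both words,
    extended by [u], through the same [psi u], the conjugate replaces [v1] by [v2] near [y]. *)
Lemma sync_local_conj (h : homeo X) K psi (g : homeo X) :
  0 < n -> sync_local h K psi ->
  higman_thompson_set g -> higman_thompson_set (g ^ h).
Proof.
move=> n0 hP /higman_thompson_prefix_replacing gP.
apply: prefix_replacing_higman_thompson => // y.
pose z := homeo_inv h y; have [k [v gE]] := gP z.
pose u := mkseq (tail k z) K.
have uK : size u = K by rewrite size_mkseq.
have [v1 h1] := hP u uK (pre k z); have [v2 h2] := hP u uK v.
have zE : pre (k + K) z = wcat (pre k z) u.
  by rewrite (pre_wcat _ (leq_addr K k)) addKn.
have [l0 l0E] :=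
  (continuous_cone _).1 (@homeo_continuous (homeo_inv h)) y (k + K)%N.
(* [l0] keeps the preimage of the cone of [pre l y] inside that of [pre (k + K) z]; the other bound
   makes [v1] a prefix of [pre l y]. *)
pose l := maxn l0 (size v1.2).
have v1l : size v1.2 <= l by exact: leq_maxr.
have yv1 : pre (size v1.2) y = v1.
  rewrite -(homeoVK h y) -/z -(dcat_pre (k + K) z) zE h1; exact: pre_dcat.
have yl := pre_wcat y v1l; set s := mkseq _ _ in yl; rewrite yv1 in yl.
exists l, (wcat v2 s) => x; set y' := dcat (pre l y) x.
have y'l : pre l y' = pre l y.
  by have := pre_dcat (pre l y) x; rewrite size_pre.
have y'z : pre (k + K) (homeo_inv h y') = pre (k + K) z.
  by apply: l0E; apply: pre_leq y'l; exact: leq_maxl.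
set x' := tail (k + K) (homeo_inv h y').
have y'E : homeo_inv h y' = dcat (wcat (pre k z) u) x'.
  by rewrite -zE -y'z dcat_pre.
have sx : psi u x' = prepend s x.
  by apply: (@dcat_inj _ _ v1); rewrite -h1 -y'E homeoVK /y' yl dcat_wcat.
rewrite conjg_homeo y'E dcat_wcat gE -dcat_wcat h2 sx dcat_wcat //.
Qed.

Definition tail_equiv (f f' : cantor n -> X) : Prop := exists v v' psi,
  (forall x, f x = dcat v (psi x)) /\ (forall x, f' x = dcat v' (psi x)).

Lemma tail_equiv_sym f f' : tail_equiv f f' -> tail_equiv f' f.
Proof. by move=> [v [v' [psi [e e']]]]; exists v', v, psi. Qed.

Lemma tail_equiv_prepend f f' s : tail_equiv f f' ->
  tail_equiv (f \o prepend s) (f' \o prepend s).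
Proof.
move=> [v [v' [psi [e e']]]]; exists v, v', (psi \o prepend s).
by split=> x /=; rewrite ?e ?e'.
Qed.

Lemma dcat_fun_eq w v (phi psi : cantor n -> cantor n) : 0 < n ->
  size w.2 <= size v.2 -> (forall x, dcat w (phi x) = dcat v (psi x)) ->
  exists2 s, v = wcat w s & forall x, phi x = prepend s (psi x).
Proof.
move=> n0 le e; pose x0 : cantor n := fun=> Ordinal n0.
have [s vE _] := dcat_eq le (e x0); exists s => // x.
have [t vE' ->] := dcat_eq le (e x).
by rewrite vE in vE'; rewrite (wcatI vE').
Qed.

Lemma tail_equiv_trans f g k : 0 < n ->
  tail_equiv f g -> tail_equiv g k -> tail_equiv f k.
Proof.
move=> n0 [v [v' [psi [e e']]]] [w [w' [phi [d d']]]].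
have vw x : dcat v' (psi x) = dcat w (phi x) by rewrite -e' -d.
have [le|/ltnW le] := leqP (size v'.2) (size w.2).
  have [s _ sE] := dcat_fun_eq n0 le vw.
  by exists (wcat v s), w', phi; split=> // x; rewrite e sE dcat_wcat.
have [s _ sE] := dcat_fun_eq n0 le (fun x => esym (vw x)).
by exists v, (wcat w' s), psi; split=> // x; rewrite d' sE dcat_wcat.
Qed.

Lemma prepend0 x : prepend [::] x = x.
Proof. by apply/funext => i; rewrite -(prepend_ge [::] x i). Qed.

(** No letter can be factored out of all values of [psi]. This normal form makes the common part in
    [tail_equiv] canonical. *)
Definition reduced (psi : cantor n -> cantor n) : Prop :=
  exists x x', psi x 0 <> psi x' 0.

Lemma reduced_prepend s psi phi : reduced psi ->
  (forall x, psi x = prepend s (phi x)) -> s = [::].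
Proof.
by case: s => // a s [x [x' ne]] e; case: ne; rewrite !e /prepend.
Qed.

Lemma tail_equiv_reduced f f' v psi : 0 < n -> reduced psi ->
  (forall x, f x = dcat v (psi x)) -> tail_equiv f f' ->
  exists v', forall x, f' x = dcat v' (psi x).
Proof.
move=> n0 psiR fE [w [w' [phi [d d']]]].
have vw x : dcat v (psi x) = dcat w (phi x) by rewrite -fE -d.
have [le|/ltnW le] := leqP (size v.2) (size w.2).
  have [s _ sE] := dcat_fun_eq n0 le vw.
  by exists w' => x; rewrite d' sE (reduced_prepend psiR sE) prepend0.
have [s _ sE] := dcat_fun_eq n0 le (fun x => esym (vw x)).
by exists (wcat w' s) => x; rewrite d' sE dcat_wcat.
Qed.

Lemma exists_reduced (f : cantor n -> X) v phi : 1 < n -> injective f ->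
  (forall x, f x = dcat v (phi x)) ->
  exists w psi, reduced psi /\ forall x, f x = dcat w (psi x).
Proof.
move=> n1 f_inj fE.
pose P k := `[< exists x x', pre k (f x) <> pre k (f x') >].
have exP : exists k, P k.
  apply: contrapT => nP.
  pose x0 : cantor n := fun=> Ordinal (ltnW n1).
  pose x1 : cantor n := fun=> Ordinal n1.
  suff /f_inj/(congr1 (fun x => val (x 0))) : f x0 = f x1 by [].
  apply: pre_ext => k; apply: contrapT => ne; apply: nP; exists k.
  by apply/asboolP; exists x0, x1.
case: (ex_minnP exP) => -[|k] /asboolP[x [x' ne]] kmin.
  (* Level 0 sees only the dotted letter, which is [v.1] for all values of [f]. *)
  by case: ne; rewrite /pre !fE.
have same x1 x2 : pre k (f x1) = pre k (f x2).
  apply: contrapT => e; suff /kmin : P k by rewrite ltnn.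
  by apply/asboolP; exists x1, x2.
exists (pre k (f x)), (fun x1 => tail k (f x1)); split; last first.
  by move=> x1; rewrite (same x x1) dcat_pre.
exists x, x' => e; apply: ne; rewrite !(pre_wcat _ (leqnSn k)) (same x x').
by rewrite subSnn /mkseq /= e.
Qed.

Section Normalizing.
Variable h : homeo X.
Hypothesis n_gt1 : 1 < n.
Hypothesis r_gt0 : 0 < r.
Hypothesis h_conj :
  forall g, higman_thompson_set g -> higman_thompson_set (g ^ h).
Let n_gt0 : 0 < n := ltnW n_gt1.

Definition local_map w x : X := h (dcat w x).

Definition equiv_below m w w' : Prop := forall u, m <= size u ->
  tail_equiv (local_map (wcat w u)) (local_map (wcat w' u)).

Lemma equiv_below_leq m m' w w' : m <= m' ->
  equiv_below m w w' -> equiv_below m' w w'.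
Proof. by move=> mm E u um; apply: E; exact: leq_trans mm um. Qed.

Lemma equiv_below_trans m w1 w2 w3 :
  equiv_below m w1 w2 -> equiv_below m w2 w3 -> equiv_below m w1 w3.
Proof. by move=> E E' u um; apply: tail_equiv_trans (E u um) (E' u um). Qed.

Lemma local_map_cat w s t :
  local_map (wcat w (s ++ t)) = local_map (wcat w s) \o prepend t.
Proof.
by apply/funext => x; rewrite /local_map /= !dcat_wcat prepend_cat.
Qed.

(** The conjugate by [h] of the exchange of the two cones carries [local_map w] to [local_map w']
    and is a prefix replacement near each point; compactness makes the level uniform. *)
Lemma incomparable_equiv_below w w' : ~~ dcomparable w w' ->
  exists m, equiv_below m w w'.
Proof.
move=> ww'; have gG : higman_thompson_set (swap ww').
  apply: prefix_replacing_higman_thompson n_gt0 _.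
  exact: swap_fun_prefix_replacing.
have /higman_thompson_prefix_replacing := h_conj gG; set g := _ ^ h => gP.
have gh x : g (local_map w x) = local_map w' x.
  by rewrite conjg_homeo homeoK /= swap_funl.
(* [uniform_level] concerns words with a dotted letter; [P] reads only the undotted part, so the
   dotted letter can be chosen freely afterwards. *)
pose P (V : dword n r) :=
  tail_equiv (local_map (wcat w V.2)) (local_map (wcat w' V.2)).
have [||m mP] := @uniform_level n r P.
- by move=> V s; rewrite /P /= !local_map_cat; exact: tail_equiv_prepend.
- move=> y; have [l [v gv]] := gP (local_map w y.2).
  have [j jE] := (continuous_cone _).1 (@homeo_continuous h) (dcat w y.2) l.
  exists j; pose phi x := tail l (local_map (wcat w (pre j y).2) x).
  have E x : local_map (wcat w (pre j y).2) x =
      dcat (pre l (local_map w y.2)) (phi x).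
    rewrite -[LHS](dcat_pre l) /local_map (jE (dcat (wcat w (pre j y).2) x)) //.
    apply: (@pre_leq _ _ _ (size w.2 + j)); first exact: leq_addl.
    rewrite dcat_wcat; apply: pre_dcat_congr => i ij.
    by rewrite (@prepend_lt _ _ _ _ (y.2 i)) ?size_mkseq // nth_mkseq.
  exists (pre l (local_map w y.2)), v, phi; split=> // x.
  by rewrite -gv -E /local_map !dcat_wcat -[LHS]gh.
exists m => u um; pose x0 : cantor n := fun=> Ordinal n_gt0.
have := mP (w.1, prepend u x0); rewrite /P /=.
have -> : mkseq (prepend u x0) m = take m u.
  apply: (@eq_from_nth _ (x0 0)); first by rewrite size_mkseq size_takel.
  move=> i; rewrite size_mkseq => im; rewrite nth_mkseq // nth_take //.
  by apply: prepend_lt; exact: leq_trans im um.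
move/(@tail_equiv_prepend _ _ (drop m u)).
by rewrite -!local_map_cat cat_take_drop.
Qed.

Lemma uniform_bound (I : finType) (P : I -> nat -> Prop) :
  (forall i m m', m <= m' -> P i m -> P i m') -> (forall i, exists m, P i m) ->
  exists m, forall i, P i m.
Proof.
move=> mono /choice[f fP]; exists (\max_i f i) => i.
by apply: mono (fP i); exact: leq_bigmax.
Qed.

Let c0 : 'I_r := Ordinal r_gt0.
Let a0 : 'I_n := Ordinal n_gt0.
Let a1 : 'I_n := Ordinal n_gt1.
Let w0 : dword n r := (c0, [:: a0]).
Let w1 : dword n r := (c0, [:: a1]).

(** [w] may be comparable with [w0], so the comparison passes through [w1], which is incomparable
    with [w0]. *)
Lemma equiv_below_w0 w : w = w1 \/ ~~ dcomparable w1 w ->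
  exists m, equiv_below m w0 w.
Proof.
have [m0 E0] : exists m, equiv_below m w0 w1.
  by apply: incomparable_equiv_below; exact: incomparable_size.
case=> [->|/incomparable_equiv_below[m E]]; first by exists m0.
exists (maxn m0 m); apply: (@equiv_below_trans _ _ w1).
  by apply: equiv_below_leq E0; exact: leq_maxl.
by apply: equiv_below_leq E; exact: leq_maxr.
Qed.

Lemma normalizing_equiv : exists m, forall u, size u = m.+1 -> forall w,
  tail_equiv (local_map (wcat w0 (behead u))) (local_map (wcat w u)).
Proof.
have [m1 E1] : exists m,
    forall p : 'I_r * 'I_n, equiv_below m w0 (p.1, [:: p.2]).
  apply: uniform_bound => [p m m'|[c a] /=]; first exact: equiv_below_leq.
  apply: equiv_below_w0.
  have [->|ne] := pselect ((c, [:: a]) = w1); [by left|right].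
  by apply: incomparable_size => // e; apply: ne.
have [m2 E2] : exists m, forall a, equiv_below m w0 (wcat w0 [:: a]).
  apply: uniform_bound => [p m m'|a]; first exact: equiv_below_leq.
  by apply: equiv_below_w0; right; rewrite /dcomparable /dprefix /=.
pose m := maxn m1 m2; exists m => u um w.
have {}E1 c a : equiv_below m w0 (c, [:: a]).
  by apply: equiv_below_leq (E1 (c, a)); exact: leq_maxl.
have {}E2 a : equiv_below m w0 (wcat w0 [:: a]).
  by apply: equiv_below_leq (E2 a); exact: leq_maxr.
case: u um => // a u [um] /=.
(* Letters are inserted after [w0] one at a time. [tail_equiv f f] forces the values of [f] to share
   their dotted letter, so the base case needs [E1], where [(c0, [:: a0])] is [w0]. *)
have E0 s : tail_equiv (local_map (wcat w0 u)) (local_map (wcat w0 (s ++ u))).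
  elim: s => [|b s IH]; first by apply: (E1 c0 a0); rewrite um.
  apply: tail_equiv_trans IH _ => //.
  have := E2 b (s ++ u); rewrite /wcat /=; apply.
  by rewrite size_cat um leq_addl.
have {E0}E c b s :
    tail_equiv (local_map (wcat w0 u)) (local_map (c, b :: s ++ u)).
  apply: tail_equiv_trans (E0 s) _ => //.
  by have := E1 c b (s ++ u); apply; rewrite size_cat um leq_addl.
(* The first letter [a] of [u] is counted with [w], which may have no undotted letter of its own;
   hence the level [m.+1]. *)
case: w => c [|b s]; first exact: (E c a [::]).
by have := E c b (rcons s a); rewrite cat_rcons.
Qed.

Lemma normalizing_sync_local : exists m psi,
  (forall u, reduced (psi u)) /\ sync_local h m.+1 psi.
Proof.
have [m mE] := normalizing_equiv; exists m.
have local_inj w : injective (local_map w).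
  move=> x x' /(congr1 (homeo_inv h)); rewrite !homeoK; exact: dcat_inj.
have /choice[psi psiP] u : exists psi, reduced psi /\ (size u = m.+1 ->
    forall w, exists v, forall x, h (dcat (wcat w u) x) = dcat v (psi x)).
  have [um|num] := pselect (size u = m.+1); last first.
    exists id; split=> //; exists (fun=> a0), (fun=> a1).
    by move/(congr1 val).
  have [v [v' [phi [e _]]]] := mE u um w0.
  have [v1 [psi [psiR e1]]] := exists_reduced n_gt1 (@local_inj _) e.
  exists psi; split=> // _ w.
  exact: tail_equiv_reduced n_gt0 psiR e1 (mE u um w).
exists psi; split=> u; first by have [] := psiP u.
by have [] := psiP u.
Qed.

End Normalizing.

End LocalActions.

(** * Synchronizing transducers act locally *)

Section Runs.
Variables n r : nat.
Local Notation X := (cantor_dot n r).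
Local Notation letter := (letter n r).
Local Notation undotted := (undotted (n := n) r).
Implicit Types (x : cantor n) (y z : X) (w v : dword n r) (s t u : seq 'I_n)
  (U Y : nat -> letter) (p o : seq letter).

Lemma undotted_cat s t : undotted (s ++ t) = undotted s ++ undotted t.
Proof. exact: map_cat. Qed.

Lemma dletters_wcat w s : dletters (wcat w s) = dletters w ++ undotted s.
Proof. by rewrite /dletters /= undotted_cat. Qed.

Lemma has_inl_undotted s : has is_inl (undotted s) = false.
Proof. by elim: s. Qed.

Lemma undottedP p : ~~ has is_inl p -> exists s, p = undotted s.
Proof.
elim: p => [|[c|a] p IH] //=; first by exists [::].
by case/IH => s ->; exists (a :: s).
Qed.

Definition lcat p U : nat -> letter :=
  fun k => if k < size p then nth (U 0) p k else U (k - size p)%N.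

Lemma lcat_lt p U i l : i < size p -> lcat p U i = nth l p i.
Proof. by move=> ip; rewrite /lcat ip; exact: set_nth_default. Qed.

Lemma lcat_ge p U i : lcat p U (size p + i)%N = U i.
Proof. by rewrite /lcat ltnNge leq_addr addKn. Qed.

Lemma mkseq_lcat p U k : mkseq (lcat p U) (size p + k) = p ++ mkseq U k.
Proof.
rewrite /mkseq iotaD map_cat; congr (_ ++ _).
  apply: (@eq_from_nth _ (U 0)); first by rewrite size_map size_iota.
  move=> i; rewrite size_map size_iota => ip.
  by rewrite (nth_map 0) ?size_iota // nth_iota // (lcat_lt _ (U 0)).
rewrite add0n -[X in iota X _]addn0 iotaDl -map_comp; apply: eq_map => i.
exact: lcat_ge.
Qed.

Lemma stream_prepend s x :
  stream r (prepend s x) = lcat (undotted s) (stream r x).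
Proof.
apply/funext => k; rewrite /stream /lcat /prepend size_map.
by case: ltnP => // ks; rewrite (nth_map (x 0)).
Qed.

Lemma dstream_dcat w x : dstream (dcat w x) = lcat (dletters w) (stream r x).
Proof.
apply/funext => -[|k] //; rewrite /dstream /dcat /=.
by have /(congr1 (@^~ k)) := stream_prepend w.2 x; rewrite /stream => ->.
Qed.

Lemma dstream_inj : injective (@dstream n r).
Proof.
move=> y z e; rewrite [y]surjective_pairing [z]surjective_pairing; congr pair.
  by have [] := congr1 (@^~ 0) e.
by apply/funext => k; have [] := congr1 (@^~ k.+1) e.
Qed.

Lemma mkseq_prefix U k p o : p ++ o = mkseq U k -> p = mkseq U (size p).
Proof.
move=> e; apply: (@eq_from_nth _ (U 0)); first by rewrite size_mkseq.
move=> i ip; rewrite nth_mkseq //.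
have := congr1 (fun o => nth (U 0) o i) e; rewrite nth_cat ip => ->.
rewrite nth_mkseq //; apply: leq_trans ip _.
by rewrite -(size_mkseq U k) -e size_cat leq_addr.
Qed.

Section Data.
Variable A : transducer_data n r.
Implicit Types q : state A.

Lemma next_word_cat p o q : next_word (p ++ o) q = next_word o (next_word p q).
Proof. by elim: p q => //= l p IH q. Qed.

Lemma out_word_cat p o q :
  out_word (p ++ o) q = out_word p q ++ out_word o (next_word p q).
Proof. by elim: p q => //= l p IH q; rewrite IH catA. Qed.

Lemma out_stream_unique U q Y Y' :
  out_stream U q Y -> out_stream U q Y' -> Y = Y'.
Proof.
move=> [e _] [e' unb]; apply/funext => i; have [k ik] := unb i.+1.
have := congr1 (fun o => nth (Y i) o i) (etrans (esym (e k)) (e' k)).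
by rewrite !nth_mkseq.
Qed.

Lemma out_stream_lcat p U q Y :
  out_stream U (next_word p q) Y ->
  out_stream (lcat p U) q (lcat (out_word p q) Y).
Proof.
move=> [e unb].
have ge k : let o := out_word (mkseq (lcat p U) (size p + k)) q in
    o = mkseq (lcat (out_word p q) Y) (size o).
  by rewrite /= mkseq_lcat out_word_cat size_cat mkseq_lcat -(e k).
split=> [k|m]; last first.
  have [k mk] := unb m; exists (size p + k)%N.
  rewrite mkseq_lcat out_word_cat size_cat; exact: leq_trans mk (leq_addl _ _).
have [pk|/ltnW kp] := leqP (size p) k; first by rewrite -(subnKC pk); exact: ge.
have pE : mkseq (lcat p U) (size p) =
    mkseq (lcat p U) k ++ [seq lcat p U i | i <- iota k (size p - k)].
  by rewrite /mkseq -map_cat -[X in iota X (_ - _)]add0n -iotaD subnKC.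
have := ge 0; rewrite addn0 pE out_word_cat; exact: mkseq_prefix.
Qed.

End Data.

Section Synchronizing.
Variable A : transducer n r.
Implicit Types q : state A.
Let AP := tdataP A.

Lemma admissible_inr a q : q != q0 A -> admissible (inr a) q.
Proof. by rewrite /admissible => /negbTE ->. Qed.

Lemma admissible_inl c : admissible (inl c) (q0 A).
Proof. by rewrite /admissible eqxx. Qed.

Lemma S_neq0 q : ~~ is_inl q -> q != q0 A.
Proof. by apply: contra => /eqP ->. Qed.

Lemma next_undotted_neq0 q s : q != q0 A -> next_word (undotted s) q != q0 A.
Proof.
elim: s q => //= a s IH q q0; apply: IH.
exact: (tnext_neq0 AP (admissible_inr a q0)).
Qed.

Lemma run_S q s : ~~ is_inl q -> ~~ is_inl (next_word (undotted s) q) /\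
  exists t, out_word (undotted s) q = undotted t.
Proof.
elim: s q => [|a s IH] q qS /=; first by split=> //; exists [::].
have [q'S [t ->]] := tnext_inS AP (admissible_inr a (S_neq0 qS)) qS.
have [? [t' ->]] := IH _ q'S; split=> //.
by exists (t ++ t'); rewrite undotted_cat.
Qed.

Lemma run_inR q s : q != q0 A -> is_inl (next_word (undotted s) q) ->
  out_word (undotted s) q = [::].
Proof.
elim: s q => //= a s IH q q0 sR; have adm := admissible_inr a q0.
have q'0 := tnext_neq0 AP adm.
have [q'R|/(run_S s)[]] := boolP (is_inl (tnext (inr a) q)); last by rewrite sR.
by rewrite (tnext_inR AP adm q'R).2 IH.
Qed.

Lemma run_RS q s :
  q != q0 A -> is_inl q -> ~~ is_inl (next_word (undotted s) q) ->
  exists v, out_word (undotted s) q = dletters v.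
Proof.
elim: s q => [|a s IH] q q0 /=; first by move=> ->.
move=> qR sS; have adm := admissible_inr a q0.
have q'0 := tnext_neq0 AP adm.
have [q'R|q'S] := boolP (is_inl (tnext (inr a) q)).
  by rewrite (tnext_inR AP adm q'R).2 /=; exact: IH.
have [v ->] := tnext_RS AP adm qR q'S; have [_ [t ->]] := run_S s q'S.
by exists (wcat v t); rewrite dletters_wcat.
Qed.

Lemma run_q0 w : ~~ is_inl (next_word (dletters w) (q0 A)) ->
  exists v, out_word (dletters w) (q0 A) = dletters v.
Proof.
case: w => c s /= sS; have adm := admissible_inl c.
have q'0 := tnext_neq0 AP adm.
have [q'R|q'S] := boolP (is_inl (tnext (inl c) (q0 A))).
  by rewrite (tnext_inR AP adm q'R).2 /=; exact: run_RS.
have [v ->] := tnext_RS AP adm isT q'S; have [_ [t ->]] := run_S s q'S.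
by exists (wcat v t); rewrite dletters_wcat.
Qed.

Lemma readable_undotted s q : q != q0 A -> readable (undotted s) q.
Proof. by rewrite /readable => /negbTE ->; rewrite has_inl_undotted. Qed.

(** Makes the level positive, so that synchronizing words are nonempty and [out_cycle] applies to
    them. *)
Lemma synchronizing_atS m : synchronizing_at A m -> synchronizing_at A m.+1.
Proof.
move=> syn [|l p] // [pm]; have [s sE] := syn p pm; exists s => q rq /=.
have adm : admissible l q.
  move: rq; rewrite /readable /admissible.
  case: (q == q0 A) => /=; first by case/andP => ->.
  by rewrite negb_or => /andP[/negbTE ->].
apply: sE; rewrite /readable (negbTE (tnext_neq0 AP adm)).
move: rq; rewrite /readable; case: eqP => _ /=; first by case/andP.
by rewrite negb_or => /andP[].
Qed.

(** A word [u] of length [m.+1] leads every state but [q0] to one state [s], so it labels a loop at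
    [s]. Loops produce output and runs inside R do not, so [s] is in S, and [psi u] is the map
    computed from [s]. *)
Lemma synchronizing_sync_local (h : X -> X) m : 0 < r ->
  synchronizing_at A m -> represents A h -> exists psi, sync_local h m.+1 psi.
Proof.
move=> r0 /synchronizing_atS syn rep; pose c0 := Ordinal r0.
have /choice[psi psiP] u : exists psi, size u = m.+1 ->
    forall w, exists v, forall x, h (dcat (wcat w u) x) = dcat v (psi x).
  have [um|num] := pselect (size u = m.+1); last by exists id.
  have [|s sE] := syn (undotted u); first by rewrite size_map.
  have {}sE q : q != q0 A -> next_word (undotted u) q = s.
    by move=> q0; apply: sE; exact: readable_undotted.
  have q10 c := tnext_neq0 AP (admissible_inl c).
  have s0 : s != q0 A by rewrite -(sE _ (q10 c0)); exact: next_undotted_neq0.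
  have sS : ~~ is_inl s.
    apply/negP => sR; have := out_cycle AP (readable_undotted u s0) _ (sE _ s0).
    rewrite run_inR ?sE // => /(_ _)/eqP; case=> //.
    by apply/eqP => /(congr1 size); rewrite size_map um.
  have /choice[psi psiP] := fun x => out_infinite AP x sS.
  exists psi => _ w.
  have ws : next_word (dletters (wcat w u)) (q0 A) = s.
    by rewrite dletters_wcat next_word_cat sE //=; exact: next_undotted_neq0.
  have [|v vE] := @run_q0 (wcat w u); first by rewrite ws.
  exists v => x; apply: dstream_inj; apply: out_stream_unique (rep _) _.
  rewrite !dstream_dcat -vE; apply: out_stream_lcat; rewrite ws; exact: psiP.
by exists psi => u um w; exact: psiP.
Qed.

End Synchronizing.

End Runs.

(** * A transducer for a local homeomorphism *)

Section Construction.
Variables n r m : nat.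
Local Notation X := (cantor_dot n r).
Local Notation K := m.+1.
Local Notation letter := (letter n r).
Local Notation undotted := (undotted (n := n) r).
Variables (h : homeo X) (psi : seq 'I_n -> cantor n -> cantor n).
Hypothesis n_gt1 : 1 < n.
Hypothesis r_gt0 : 0 < r.
Hypothesis psi_reduced : forall u, reduced (psi u).
Hypothesis h_psi : sync_local h K psi.
Implicit Types (x : cantor n) (y z : X) (w v : dword n r) (s t u : seq 'I_n).

Let n_gt0 : 0 < n := ltnW n_gt1.
Let c0 : 'I_r := Ordinal r_gt0.

(** The subtraction is truncated, so a word of at most [K] letters is kept whole. *)
Definition last_letters s := drop (size s - K) s.

Lemma last_letters_cat s t : size t = K -> last_letters (s ++ t) = t.
Proof. by move=> tK; rewrite /last_letters size_cat tK addnK drop_size_cat. Qed.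

Lemma size_last_letters s : K <= size s -> size (last_letters s) = K.
Proof. by move=> sK; rewrite /last_letters size_drop subKn. Qed.

Lemma last_letters_rcons s a : K <= size s ->
  last_letters (rcons (last_letters s) a) = last_letters (rcons s a).
Proof.
move=> sK; rewrite /last_letters !size_rcons size_drop subKn // subSnn.
by rewrite subSn // -drop_rcons ?leq_subr // drop_drop add1n.
Qed.

(** Both maps describe [h] on one cone, as [rcons u a] is one letter followed by its last [K]
    letters. The map on the right is reduced, so the prefix on the left is never the strictly longer
    one. *)
Lemma output_exists u a : size u = K -> exists p,
  forall x,
    psi u (prepend [:: a] x) = prepend p (psi (last_letters (rcons u a)) x).
Proof.
move=> uK; pose w : dword n r := (c0, [::]).
have u'K : size (last_letters (rcons u a)) = K.
  by apply: size_last_letters; rewrite size_rcons uK.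
have [v vE] := h_psi uK w.
have [v' v'E] := h_psi u'K (wcat w (take 1 (rcons u a))).
have vv' x : dcat v (psi u (prepend [:: a] x)) =
    dcat v' (psi (last_letters (rcons u a)) x).
  rewrite -vE -v'E -dcat_wcat; congr (h (dcat _ x)); rewrite /wcat /= cats1.
  by rewrite /last_letters size_rcons uK subSnn cat_take_drop.
have [le|/ltnW le] := leqP (size v.2) (size v'.2).
  have [p _ pE] := dcat_fun_eq n_gt0 le vv'; by exists p.
have [p _ pE] := dcat_fun_eq n_gt0 le (fun x => esym (vv' x)).
exists [::] => x; rewrite prepend0 pE.
by rewrite (reduced_prepend (psi_reduced _) pE) prepend0.
Qed.

Definition out_S u a : seq 'I_n := xget [::] [set p | forall x,
  psi u (prepend [:: a] x) = prepend p (psi (last_letters (rcons u a)) x)].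

Lemma out_SE u a x : size u = K ->
  psi u (prepend [:: a] x) =
  prepend (out_S u a) (psi (last_letters (rcons u a)) x).
Proof.
move=> /(output_exists a)[p pE].
rewrite /out_S; set P := [set _ | _]; have Pp : P p by [].
exact: (xgetI _ Pp x).
Qed.

Definition out_R c u : dword n r :=
  xget (c, [::]) [set v | forall x, h (dcat (c, u) x) = dcat v (psi u x)].

Lemma out_RE c u x :
  size u = K -> h (dcat (c, u) x) = dcat (out_R c u) (psi u x).
Proof.
move=> uK; have [v vE] := h_psi uK (c, [::]).
rewrite /out_R; set P := [set _ | _]; have Pv : P v by [].
exact: (xgetI _ Pv x).
Qed.

Local Notation R := (option ('I_r * m.-bseq 'I_n)).
Local Notation S := (K.-tuple 'I_n).

(* The state reached from [q0] by reading [c s] remembers [s] while it has at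
   most [m] letters, and its last [m.+1] letters afterwards. *)
Definition reached c s : R + S :=
  if insub (last_letters s) is Some u then inr u
  else inl (Some (c, insub_bseq m s)).

(** [None] is [q0]. States in S have forgotten the dotted letter, so [c0] is a placeholder there;
    values at inadmissible pairs are arbitrary. *)
Definition local_next (l : letter) (q : R + S) : R + S :=
  match l, q with
  | inl c, _ => reached c [::]
  | inr _, inl None => q
  | inr a, inl (Some (c, s)) => reached c (rcons s a)
  | inr a, inr u => reached c0 (rcons u a)
  end.

(** Output is withheld until the letter that completes [K = m.+1] undotted letters, where [h_psi]
    provides a dotted prefix. *)
Definition local_out (l : letter) (q : R + S) : seq letter :=
  match l, q with
  | inr a, inl (Some (c, s)) =>
      if size s == m then dletters (out_R c (rcons s a)) else [::]
  | inr a, inr u => undotted (out_S u a)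
  | _, _ => [::]
  end.

Definition local_data : transducer_data n r :=
  @TransducerData n r R S None local_next local_out.

Lemma reached_R c s (sm : size s <= m) : reached c s = inl (Some (c, Bseq sm)).
Proof.
rewrite /reached insubN; last first.
  rewrite /last_letters (_ : size s - K = 0)%N ?drop0; last first.
    by apply/eqP; rewrite subn_eq0 leqW.
  by rewrite neq_ltn ltnS sm.
congr (inl (Some (c, _))); apply: val_inj.
by rewrite /= /insub_bseq val_insubd sm.
Qed.

Lemma reached_S c s (sK : size (last_letters s) == K) :
  reached c s = inr (Tuple sK).
Proof. by rewrite /reached insubT. Qed.

Lemma reached_tuple c (u : S) : reached c u = inr u.
Proof.
have uK : size (last_letters u) == K.
  by rewrite size_last_letters // size_tuple.
rewrite (reached_S c uK); congr inr; apply: val_inj.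
by rewrite /= -[X in last_letters X]cat0s last_letters_cat // size_tuple.
Qed.

Lemma reached_bseq c (s : m.-bseq 'I_n) : reached c s = inl (Some (c, s)).
Proof.
rewrite (reached_R c (size_bseq s)).
by congr (inl (Some (c, _))); exact: val_inj.
Qed.

Lemma is_inl_reached c s : is_inl (reached c s) = (size s <= m).
Proof.
have [sm|ms] := leqP (size s) m; first by rewrite reached_R.
have sK := size_last_letters ms; move/eqP: sK => sK.
by rewrite (reached_S c sK).
Qed.

Lemma reached_neq0 c s : reached c s != q0 local_data.
Proof. by rewrite /reached; case: insub. Qed.

Lemma neq0_reached (q : state local_data) : q != q0 local_data ->
  exists c s, q = reached c s.
Proof.
case: q => [[[c s]|]|u] // _; first by exists c, s; rewrite reached_bseq.
by exists c0, u; rewrite reached_tuple.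
Qed.

Lemma next_reached c s a :
  local_next (inr a) (reached c s) = reached c (rcons s a).
Proof.
have [sm|ms] := leqP (size s) m; first by rewrite (reached_R c sm).
have sK := size_last_letters ms; move/eqP: (sK) => sK'.
rewrite (reached_S c sK') /=.
rewrite /reached last_letters_rcons //.
case: insubP => // /negP[]; rewrite size_last_letters // size_rcons.
exact: ltnW.
Qed.

Lemma next_word_reached c s t :
  next_word (A := local_data) (undotted t) (reached c s) = reached c (s ++ t).
Proof.
elim: t s => [|a t IH] s; first by rewrite cats0.
by rewrite -cat_rcons -IH -next_reached.
Qed.

Lemma psi_inj u : size u = K -> injective (psi u).
Proof.
move=> uK x x' e; have [v vE] := h_psi uK (c0, [::]).
have : h (dcat (wcat (c0, [::]) u) x) = h (dcat (wcat (c0, [::]) u) x').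
  by rewrite !vE e.
by move/(congr1 (homeo_inv h)); rewrite !homeoK => /dcat_inj.
Qed.

Lemma run_tuple (u : S) s : exists (u' : S) t,
  [/\ next_word (A := local_data) (undotted s) (inr u) = inr u',
      out_word (A := local_data) (undotted s) (inr u) = undotted t &
      forall x, psi u (prepend s x) = prepend t (psi u' x)].
Proof.
elim: s u => [|a s IH] u.
  by exists u, [::]; split=> // x; rewrite !prepend0.
have uK : K <= size (rcons u a) by rewrite size_rcons size_tuple.
have /eqP aK := size_last_letters uK.
have [u' [t [nE oE pE]]] := IH (Tuple aK).
exists u', (out_S u a ++ t); split.
- by rewrite /= (reached_S c0 aK).
- by rewrite /= (reached_S c0 aK) oE undotted_cat.
- move=> x; rewrite (prepend_cat [:: a] s) out_SE ?size_tuple //.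
  by rewrite prepend_cat -pE.
Qed.

Lemma psi_continuous u x k : size u = K ->
  exists l, forall x', (forall i, i < l -> x' i = x i) ->
    forall i, i < k -> psi u x' i = psi u x i.
Proof.
move=> uK; have [v vE] := h_psi uK (c0, [::]).
set w := wcat _ _ in vE.
have [l lE] := (continuous_cone _).1 (@homeo_continuous _ _ h) (dcat w x)
  (size v.2 + k)%N.
exists l => x' xx' i ik.
have := lE (dcat w x'); rewrite !vE => /(_ _)/preP[].
  apply: (@pre_leq _ _ _ (size w.2 + l)); first exact: leq_addl.
  exact: pre_dcat_congr.
by move=> _ /(_ (size v.2 + i)%N) /=; rewrite !prepend_ge ltn_add2l; apply.
Qed.

Lemma mkseq_stream x k : mkseq (stream r x) k = undotted (mkseq x k).
Proof. by rewrite /mkseq /undotted -map_comp. Qed.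

Lemma prepend_mkseq x k : exists x', x = prepend (mkseq x k) x'.
Proof.
by exists (tail k (c0, x)); exact: (esym (congr1 snd (dcat_pre k (c0, x)))).
Qed.

Lemma out_stream_tuple (u : S) x :
  out_stream (A := local_data) (stream r x) (inr u) (stream r (psi u x)).
Proof.
split=> [k|k].
  rewrite mkseq_stream; have [u' [t [_ -> tE]]] := run_tuple u (mkseq x k).
  have [x' xE] := prepend_mkseq x k.
  have -> : psi u x = prepend t (psi u' x') by rewrite -tE -xE.
  rewrite stream_prepend /= -[X in mkseq _ X]addn0 mkseq_lcat.
  by rewrite cats0.
have [l lE] := psi_continuous x k (size_tuple u).
exists l; rewrite mkseq_stream.
have [u' [t [_ -> tE]]] := run_tuple u (mkseq x l).
rewrite size_map leqNgt; apply/negP => tk.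
(* If the output were shorter than [k], continuity would fix the letter of [psi u] at position
   [size t], which is the first letter of [psi u']. *)
have [x1 [x2 ne]] := psi_reduced u'; apply: ne.
have const x' : psi u' x' 0 = psi u x (size t).
  rewrite -(lE (prepend (mkseq x l) x')) //.
    by rewrite tE -[in RHS](addn0 (size t)) prepend_ge.
  move=> i il; rewrite (@prepend_lt _ _ _ _ (x 0)) ?size_mkseq //.
  by rewrite nth_mkseq.
by rewrite !const.
Qed.

Lemma local_nondegenerate : nondegenerate local_data.
Proof.
split.
- by move=> [c|a] [[[c' s]|]|u] //= _; exact: reached_neq0.
- move=> [c|a] [[[c' s]|]|u] //= _; rewrite is_inl_reached size_rcons.
    by rewrite ltn_neqAle => /andP[/negbTE ->].
  by rewrite size_tuple ltnNge leqnSn.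
- move=> [c|a] [[[c' s]|]|u] //= _ _; rewrite is_inl_reached.
    by [].
  rewrite size_rcons -ltnNge ltnS => ms.
  have -> : size s == m by rewrite eqn_leq size_bseq ms.
  by exists (out_R c' (rcons s a)).
- move=> [c|a] [[[c' s]|]|u] //= _ _.
  rewrite is_inl_reached size_rcons size_tuple.
  by rewrite -ltnNge ltnW //; split=> //; exists (out_S u a).
- move=> w q; rewrite /readable; case: eqP => [->|/eqP q0' /undottedP[s ->]].
    case: w => [|l w] //= /andP[+ /undottedP[s ->]] _.
    case: l => [c|//] _; rewrite -/local_data.
    move=> e; have := reached_neq0 c s; rewrite -[s]cat0s -next_word_reached.
    by rewrite [X in X != _]e eqxx.
  move=> s0 e; apply/eqP => o0.
  case: q q0' e o0 => [[[c t]|]|u] // _ e o0.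
    (* There are no loops in R: the remembered word grows with each letter. *)
    move: e s0; rewrite -reached_bseq next_word_reached => e.
    have tm : size (t ++ s) <= m.
      by rewrite -(is_inl_reached c) e is_inl_reached size_bseq.
    move: e; rewrite (reached_R c tm) reached_bseq.
    move=> -[/(congr1 (size \o val))] /=.
    by rewrite size_cat -[RHS]addn0 => /addnI/size0nil ->.
  have [u' [t [nE oE tE]]] := run_tuple u s.
  move: nE oE; rewrite e o0 => -[uu'] /esym/(congr1 size).
  rewrite size_map => /size0nil t0.
  case: s s0 {e o0} tE => // a s _ tE.
  (* On a silent loop, injectivity of [psi u] would make prepending [a :: s] the identity; the
     constant sequence of a letter [b] other than [a] refutes this. *)
  pose b : 'I_n := if a == Ordinal n_gt0 then Ordinal n_gt1 else Ordinal n_gt0.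
  have := tE (fun=> b); rewrite t0 -uu' prepend0 => /psi_inj.
  rewrite size_tuple => /(_ erefl)/(congr1 (@^~ 0)); rewrite /prepend /= /b.
  by case: eqP => [-> //|ne /ne].
- move=> [[]|u] // x _; exists (psi u x); exact: out_stream_tuple.
Qed.

Definition local_transducer : transducer n r := Transducer local_nondegenerate.

Lemma local_represents : represents local_transducer h.
Proof.
move=> y; pose w := pre K y.
have wK : size w.2 = K by rewrite size_pre.
have wR : size (take m w.2) <= m by rewrite size_take_min geq_minl.
have [s [a [sm wE]]] : exists s a, size s = m /\ w.2 = rcons s a.
  by case/lastP: (w.2) wK => // s a; rewrite size_rcons => -[sm]; exists s, a.
have dwE : dletters w = inl w.1 :: undotted (rcons s a) by rewrite /dletters wE.
have /eqP tK : size (last_letters w.2) = K.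
  by apply: size_last_letters; rewrite wK.
have nE : next_word (A := local_data) (dletters w) (q0 local_data) =
    inr (Tuple tK).
  rewrite dwE /= -/local_data next_word_reached cat0s -wE; exact: reached_S.
have outR t : size t <= m ->
    out_word (A := local_data) (dletters (w.1, t)) (q0 local_data) = [::].
  elim/last_ind: t => [//|t b IH]; rewrite size_rcons => tm.
  rewrite -cats1 (dletters_wcat (w.1, t)) out_word_cat IH 1?ltnW //=.
  rewrite -/local_data next_word_reached cat0s (reached_R _ (ltnW tm)) /=.
  by rewrite ltn_eqF.
have oE : out_word (A := local_data) (dletters w) (q0 local_data) =
    dletters (out_R w.1 w.2).
  have -> : w = wcat (w.1, s) [:: a] by rewrite /wcat /= cats1 -wE.
  have sm' : size s <= m by rewrite sm.
  rewrite dletters_wcat out_word_cat outR //=.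
  rewrite -/local_data next_word_reached cat0s.
  by rewrite (reached_R _ sm') /= sm eqxx cats0 cats1.
rewrite -{1}(dcat_pre K y) -[X in h X](dcat_pre K y).
rewrite [pre K y]surjective_pairing out_RE // -surjective_pairing.
rewrite !dstream_dcat -/w -oE.
apply: out_stream_lcat; rewrite nE.
have -> : psi w.2 = psi (Tuple tK).
  by rewrite -[X in psi X = _](last_letters_cat [::] wK).
exact: out_stream_tuple.
Qed.

(** After [K] undotted letters the state is exactly those letters; words with a dotted letter are
    readable from [q0] at most. *)
Lemma local_synchronizing : synchronizing_at local_transducer K.
Proof.
move=> w wK; have [wl|/undottedP[t wE]] := boolP (has is_inl w).
  exists (next_word w (q0 local_transducer)) => q.
  by rewrite /readable; case: eqP => [-> //|_]; rewrite wl.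
have tK : size t = K by rewrite -wK wE size_map.
exists (reached c0 t) => q; rewrite /readable.
case: eqP => [_|/eqP/neq0_reached[c [s ->]] _].
  by move: tK; rewrite wE; case: (t).
rewrite wE next_word_reached /reached last_letters_cat //.
rewrite -[X in last_letters X]cat0s.
rewrite last_letters_cat //; case: insubP => //.
by rewrite tK eqxx.
Qed.

Lemma local_finite : finite_transducer local_transducer.
Proof. exact: (@finite_finset (R + S)%type). Qed.

Theorem sync_local_representable : sync_representable h.
Proof.
exists local_transducer; split.
- exact: local_finite.
- by exists K; exact: local_synchronizing.
- exact: local_represents.
Qed.

End Construction.

(** * Bi-synchronizing homeomorphisms as the normalizer *)

Section Normalizer.
Variables n r : nat.
Hypothesis n_gt1 : 1 < n.
Hypothesis r_gt0 : 0 < r.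
Local Notation X := (cantor_dot n r).
Local Notation HT := (@higman_thompson_set n r).
Local Notation G := (subgroup_type (higman_thompson n r)).
Implicit Types (g h : homeo X).

Let n_gt0 : 0 < n := ltnW n_gt1.

(** Applied to [h] and to its inverse, this identifies the bi-synchronizing homeomorphisms with the
    normalizer. *)
Lemma sync_representableP h :
  sync_representable h <-> forall g, HT g -> HT (g ^ h).
Proof.
split=> [[A [_ [m syn] rep]] g|norm].
  have [psi hP] := synchronizing_sync_local r_gt0 syn rep.
  exact: sync_local_conj n_gt0 hP.
have [m [psi [psiR hP]]] := normalizing_sync_local n_gt1 r_gt0 norm.
exact: sync_local_representable n_gt1 r_gt0 psiR hP.
Qed.

Lemma bisynchronizing_group_closed : group_closed (mem (bisynchronizing n r)).
Proof.
split.
  by apply/mem_set; split; apply/sync_representableP => g; rewrite ?invg1 conjg1.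
move=> h k /set_mem[/sync_representableP h1 /sync_representableP h2].
move=> /set_mem[/sync_representableP k1 /sync_representableP k2].
apply/mem_set; split; apply/sync_representableP => g Gg.
  by rewrite conjgM; apply/k2/h1.
by rewrite invgF conjgM; apply/h2/k1.
Qed.

Definition bisynchronizing_subgroup : subgroup (homeo X) :=
  Subgroup bisynchronizing_group_closed.
Local Notation B := (subgroup_type bisynchronizing_subgroup).

Lemma higman_thompson_bisynchronizing : HT `<=` bisynchronizing n r.
Proof.
have HTJ g h : HT g -> HT h -> HT (g ^ h).
  move=> Gg Gh; rewrite conjgE; apply: higman_thompson_mul.
    exact: higman_thompson_inv.
  exact: higman_thompson_mul.
move=> h Gh; split; apply/sync_representableP => g Gg; apply: HTJ => //.
exact: higman_thompson_inv.
Qed.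

Lemma bisynchronizing_conj h : bisynchronizing n r h ->
  forall g : G, val g ^ h \in (higman_thompson n r : set _).
Proof.
move=> [/sync_representableP hG _] g; apply/mem_set; apply: hG.
exact: set_mem (valP g).
Qed.

Definition conj_fun (b : B) (g : G) : G :=
  exist _ (val g ^ val b) (bisynchronizing_conj (set_mem (valP b)) g).

Lemma conj_funM (b : B) : {morph conj_fun b : g h / g * h}.
Proof. by move=> g h; apply: val_inj; exact: conjMg. Qed.

Lemma conj_fun_bij (b : B) : bijective (conj_fun b).
Proof.
exists (conj_fun b^-1) => g; apply: val_inj; first exact: conjgK.
exact: conjgKV.
Qed.

Definition conj_aut (b : B) : Aut G :=
  Automorphism (conj_funM b) (conj_fun_bij b).

Lemma conj_autM : {morph conj_aut : b c / b * c}.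
Proof.
by move=> b c; apply: aut_ext => g; apply: val_inj; exact: conjgM.
Qed.

HB.instance Definition _ := isMultiplicative.Build B (Aut G) conj_aut conj_autM.

Lemma conj_aut_inj : injective conj_aut.
Proof.
move=> b c e; apply: val_inj; apply/eqP; rewrite -divg_eq1; apply/eqP.
apply: homeo_ext; apply: (higman_thompson_centralizer n_gt1) => g y.
have gbc : val g ^ val b = val g ^ val c.
  exact: (congr1 (fun a : Aut G => val (a g)) e).
have := congr1 (fun k : homeo X => homeo_inv (val c) (k (val b y))) gbc.
by rewrite !conjg_homeo !homeoK.
Qed.

Lemma conj_aut_surj (a : Aut G) : exists b, conj_aut b = a.
Proof.
have [phi phiE] := higman_thompson_rubin n_gt1 a.
have aE (g : G) : val (a g) = val g ^ phi.
  apply: homeo_ext => y; rewrite conjg_homeo.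
  by have := phiE g (homeo_inv phi y); rewrite /ht_act homeoVK => <-.
have Bphi : bisynchronizing n r phi.
  split; apply/sync_representableP => g /mem_set Gg.
    have <- := aE (exist _ g Gg); exact: set_mem (valP _).
  (* Writing [g] as the image under [a] of [aut_inv a g] shows that [g ^ phi^-1] is [aut_inv a g],
     an element of the group. *)
  have /(congr1 (fun k => val k ^ phi^-1)) := autVK a (exist _ g Gg).
  rewrite aE conjgK => /= <-.
  exact: (set_mem (valP (aut_inv a (exist _ g Gg)))).
exists (exist _ phi (mem_set Bphi)).
by apply: aut_ext => g; apply: val_inj; rewrite aE.
Qed.

Lemma bisynchronizing_isomorphic : isomorphic B (Aut G).
Proof.
exists conj_aut; have /choice[f fK] := conj_aut_surj.
by exists f => // b; apply: conj_aut_inj; rewrite fK.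
Qed.

End Normalizer.

Local Close Scope group_scope.

Theorem theorem1p1 (n r : nat) (hr : 1 <= r) (hrn : r < n) :
  bisynchronizing n r `<=` rational n r /\
  exists B_group : group_closed (mem (bisynchronizing n r)),
    let B := Subgroup B_group in
    higman_thompson n r `<=` B /\
    isomorphic (subgroup_type B) (Aut (subgroup_type (higman_thompson n r))).
Proof.
have n_gt1 : 1 < n := leq_ltn_trans hr hrn.
split; first by move=> h [[A [Afin _ Arep]] _]; exists A.
exists (bisynchronizing_group_closed n_gt1 hr); split.
  exact: higman_thompson_bisynchronizing.
exact: bisynchronizing_isomorphic.
Qed.
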